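(* Let $d$ be a positive integer, let $\gamma>0$, and let $A\colon\mathbb Z^+_0\to\mathbb C^{d\times d}$ satisfy $$\sum_{j=0}^\infty|A(j)|e^{\gamma j}<\infty .$$ Consider the linear Volterra difference equation with infinite delay $$x(n+1)=\sum_{j=-\infty}^nA(n-j)\,x(j)\qquad(\ast)$$ in the phase space $\mathcal B_\gamma$. Then the following statements are equivalent: (i) Equation $(\ast)$ is shadowable on $\mathbb Z^+_0$; (ii) The characteristic equation $$\det\varDelta(\lambda)=0,\qquad |\lambda|>e^{-\gamma},\qquad\text{where}\quad \varDelta(\lambda)=\lambda E-\sum_{j=0}^\infty\lambda^{-j}A(j),$$ has no root $\lambda\in\mathbb C$ on the unit circle $|\lambda|=1$.
   Context: Notation. $\mathbb Z^+_0=\{n\in\mathbb Z:n\ge0\}$, $\mathbb Z^-_0=\{n\in\mathbb Z:n\le0\}$. $\mathbb C^d$ is the space of complex $d$-dimensional column vectors with a norm $|\cdot|$, $\mathbb C^{d\times d}$ is the space of complex $d\times d$ matrices with the induced operator norm $|\cdot|$, and $E\in\mathbb C^{d\times d}$ is the unit matrix. Phase space. $\mathcal B_\gamma$ is the Banach space of all functions $\phi\colon\mathbb Z^-_0\to\mathbb C^d$ with $\|\phi\|:=\sup_{\theta\in\mathbb Z^-_0}|\phi(\theta)|e^{\gamma\theta}<\infty$. For $x\colon\mathbb Z\to\mathbb C^d$ and $n\in\mathbb Z^+_0$, the segment $x_n\colon\mathbb Z^-_0\to\mathbb C^d$ is $x_n(\theta)=x(n+\theta)$. The bounded linear map $L\colon\mathcal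 B_\gamma\to\mathbb C^d$ is $L(\phi)=\sum_{j=0}^\infty A(j)\phi(-j)$, so that $(\ast)$ reads $x(n+1)=L(x_n)$. Solutions. For every $\phi\in\mathcal B_\gamma$ there is a unique function $x\colon\mathbb Z\to\mathbb C^d$ satisfying $(\ast)$ for all $n\in\mathbb Z^+_0$ and $x(\theta)=\phi(\theta)$ for $\theta\in\mathbb Z^-_0$; it is called the solution of $(\ast)$ on $\mathbb Z^+_0$ with initial value $x_0=\phi$. A solution of $(\ast)$ on $\mathbb Z^+_0$ is a solution with initial value $x_0=\phi$ for some $\phi\in\mathcal B_\gamma$. Shadowing. Equation $(\ast)$ is shadowable on $\mathbb Z^+_0$ if for each $\epsilon>0$ there exists $\delta>0$ such that for every function $y\colon\mathbb Z\to\mathbb C^d$ with $y_0\in\mathcal B_\gamma$ (hence $y_n\in\mathcal B_\gamma$ for all $n\ge0$) satisfying $\sup_{n\ge0}|y(n+1)-L(y_n)|\le\delta$ there exists a solution $x$ of $(\ast)$ on $\mathbb Z^+_0$ such that $\sup_{n\ge0}\|x_n-y_n\|\le\epsilon$. *)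

(* Defs.v *)
From HB Require Import structures.
From mathcomp Require Import all_boot all_order all_algebra.
From mathcomp Require Import all_classical all_reals all_analysis.
From mathcomp Require Import complex.

Set Implicit Arguments.
Unset Strict Implicit.
Unset Printing Implicit Defensive.

Import Order.TTheory GRing.Theory Num.Theory.
Import numFieldNormedType.Exports.

Local Open Scope classical_set_scope.
Local Open Scope complex_scope.
Local Open Scope ring_scope.

(* The complex numbers, packaged as a [numClosedFieldType] so that the generic
   topology of numeric fields, and the induced topology on matrices, apply.
   The modulus [`|z|] is itself an element of [Cplx R]; real numbers are
   compared with it through the embedding [%:C]. *)
Definition Cplx (R : realType) : numClosedFieldType := R[i].
Arguments Cplx : simpl never.

Definition Zle0 := {theta : int | theta <= 0}.

Fact oppz_nat_le0 (j : nat) : - j%:Z <= 0.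
Proof. by rewrite oppr_le0. Qed.

Definition negz_nat (j : nat) : Zle0 := exist _ (- j%:Z) (oppz_nat_le0 j).

Section Volterra.
Context {R : realType} {d : nat}.
Local Notation C := (Cplx R).

Record is_norm (N : 'cV[C]_d -> R) : Prop := IsNorm {
  is_norm_ge0 : forall u, 0 <= N u;
  is_norm_eq0 : forall u, N u = 0 -> u = 0;
  is_normZ : forall (a : C) u, ((N (a *: u))%:C : C) = `|a| * (N u)%:C;
  is_normD : forall u v, N (u + v) <= N u + N v }.

Definition op_norm (N : 'cV[C]_d -> R) (M : 'M[C]_d) : \bar R :=
  ereal_sup [set (N (M *m u))%:E | u in [set u | N u <= 1]].

Definition phase_norm (N : 'cV[C]_d -> R) (gamma : R)
    (phi : Zle0 -> 'cV[C]_d) : \bar R :=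
  ereal_sup (range (fun theta : Zle0 =>
    (N (phi theta) * expR (gamma * (val theta)%:~R))%:E)).

Definition phase_space (N : 'cV[C]_d -> R) (gamma : R) :
    set (Zle0 -> 'cV[C]_d) :=
  [set phi | (phase_norm N gamma phi < +oo)%E].

Definition segment (x : int -> 'cV[C]_d) (n : nat) : Zle0 -> 'cV[C]_d :=
  fun theta => x (n%:Z + val theta).

Definition volterra_op (A : nat -> 'M[C]_d) (phi : Zle0 -> 'cV[C]_d) :
    'cV[C]_d :=
  limn (series (fun j : nat => A j *m phi (negz_nat j))).

Definition is_solution_from (A : nat -> 'M[C]_d) (phi : Zle0 -> 'cV[C]_d)
    (x : int -> 'cV[C]_d) : Prop :=
  (forall n : nat, x (n%:Z + 1) = volterra_op A (segment x n)) /\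
  (forall theta : Zle0, x (val theta) = phi theta).

Definition is_solution (N : 'cV[C]_d -> R) (gamma : R) (A : nat -> 'M[C]_d)
    (x : int -> 'cV[C]_d) : Prop :=
  exists2 phi, phase_space N gamma phi & is_solution_from A phi x.

Definition shadowable (N : 'cV[C]_d -> R) (gamma : R)
    (A : nat -> 'M[C]_d) : Prop :=
  forall eps : R, 0 < eps -> exists2 delta : R, 0 < delta &
    forall y : int -> 'cV[C]_d,
      phase_space N gamma (segment y 0) ->
      (ereal_sup (range (fun n : nat =>
         (N (y (n%:Z + 1) - volterra_op A (segment y n)))%:E))
         <= delta%:E)%E ->
      exists2 x : int -> 'cV[C]_d, is_solution N gamma A x &
        (ereal_sup (range (fun n : nat =>
           phase_norm N gamma (fun theta =>
             (segment x n theta - segment y n theta)%R))) <= eps%:E)%E.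

Definition char_mx (A : nat -> 'M[C]_d) (lambda : C) : 'M[C]_d :=
  lambda%:M - limn (series (fun j : nat => lambda ^- j *: A j)).

Definition char_root (gamma : R) (A : nat -> 'M[C]_d) (lambda : C) : Prop :=
  (expR (- gamma))%:C < `|lambda| /\ \det (char_mx A lambda) = 0.

End Volterra.

(* Main.v *)
(* Subtracting a true solution x from a pseudo-solution y turns shadowing
   into the problem of finding, for a bounded f, a bounded z such that
   z(n+1) = L(z_n) + f(n) for all n >= 0.

   If Delta is invertible on the unit circle, extend the restriction of f to
   [0, M) to an M-periodic sequence and solve by the discrete Fourier
   transform. The solution is the convolution of f with the periodic Green
     function
     G_M(m) = (1/M) sum_{w^M = 1} w^m Delta(w)^-1.
   Since sum_j j^2 |A(j)| is finite and Delta^-1 is bounded on the circle,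
   the second differences of Delta^-1 along the M-th roots of unity are
   O(1/M^2); summing by parts twice gives |G_M(m)| = O(1/m^2 + 1/(M-m)^2),
   so the l^1 norm of G_M over a period, hence |z|, is bounded uniformly in
   M. A pointwise limit as M tends to infinity along an ultrafilter gives z.

   Conversely, let Delta(lambda) be singular with |lambda| = 1, and let q
   be a nonzero row vector with q Delta(lambda) = 0. Forcing the equation
   with small multiples of lambda^n w, where q w <> 0, yields a
   pseudo-solution; if it were shadowed, then summing lambda^-n z(n) for n
   in [0, M) and applying q would give |M q w| = O(1). *)
Require Import Defs.
From mathcomp Require Import all_boot all_order all_algebra.
From mathcomp Require Import all_classical all_reals all_analysis.
From mathcomp Require Import complex.
From mathcomp Require Import ring lra.

Import Order.TTheory GRing.Theory Num.Theory.
Import numFieldNormedType.Exports.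

Local Open Scope ring_scope.

Set Implicit Arguments.
Unset Strict Implicit.
Unset Printing Implicit Defensive.

(** * Moduli and entrywise norms *)

Section EntrywiseNorm.
Context {R : realType}.
Local Notation C := (Cplx R).

Definition cabs (z : C) : R := ComplexField.Normc.normc z.

Lemma normr_cabs (z : C) : `|z| = (cabs z)%:C%C.
Proof. by []. Qed.

Lemma cabs_eq (z : C) (r : R) : `|z| = r%:C%C -> cabs z = r.
Proof. by rewrite normr_cabs => /complexI. Qed.

Lemma cabs_ge0 (z : C) : 0 <= cabs z.
Proof. by rewrite -ler0c -[_%:C%C]normr_cabs. Qed.

Lemma cabs0 : cabs 0 = 0.
Proof. by apply: cabs_eq; rewrite normr0. Qed.

Lemma cabs1 : cabs 1 = 1.
Proof. by apply: cabs_eq; rewrite normr1. Qed.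

Lemma cabsM (z w : C) : cabs (z * w) = cabs z * cabs w.
Proof. exact: ComplexField.Normc.normcM. Qed.

Lemma cabsX (z : C) n : cabs (z ^+ n) = cabs z ^+ n.
Proof. by elim: n => [|n IH]; rewrite ?cabs1 // !exprS cabsM IH. Qed.

Lemma cabsN (z : C) : cabs (- z) = cabs z.
Proof. by apply: cabs_eq; rewrite normrN. Qed.

Lemma cabsV (z : C) : cabs z^-1 = (cabs z)^-1.
Proof. exact: ComplexField.Normc.normcV. Qed.

Lemma cabsD (z w : C) : cabs (z + w) <= cabs z + cabs w.
Proof.
rewrite -lecR rmorphD /= -[_%:C%C]/(`|z + w|) -[(cabs z)%:C%C]/(`|z|).
by rewrite -[(cabs w)%:C%C]/(`|w|) ler_normD.
Qed.

Lemma cabs_eq0 (z : C) : cabs z = 0 -> z = 0.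
Proof. exact: ComplexField.Normc.eq0_normc. Qed.

Lemma cabs_sum (I : Type) (r : seq I) (P : pred I) (F : I -> C) :
  cabs (\sum_(i <- r | P i) F i) <= \sum_(i <- r | P i) cabs (F i).
Proof.
elim/big_rec2: _ => [|i y x _ le_xy]; first by rewrite cabs0.
exact: le_trans (cabsD _ _) (lerD _ _).
Qed.

Lemma cabs_real (x : R) : cabs (x%:C%C) = `|x|.
Proof. by rewrite /cabs /= expr0n /= addr0 sqrtr_sqr. Qed.

Lemma cabs_ReIm (z : C) : cabs z <= `|complex.Re z| + `|complex.Im z|.
Proof.
case: z => a b /=; rewrite /cabs /=.
rewrite -[leRHS]ger0_norm ?addr_ge0 // -[leRHS]sqrtr_sqr ler_wsqrtr //.
rewrite sqrrD !real_normK ?num_real // lerD2r lerDl.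
by rewrite mulrn_wge0 // mulr_ge0.
Qed.

Lemma Re_le_cabs (z : C) : `|complex.Re z| <= cabs z.
Proof. by rewrite -lecR -[(cabs z)%:C%C]/(`|z|); exact: normc_ge_Re. Qed.

Lemma Im_le_cabs (z : C) : `|complex.Im z| <= cabs z.
Proof.
case: z => a b /=; rewrite /cabs /= -[leLHS]sqrtr_sqr ler_wsqrtr //.
by rewrite lerDr sqr_ge0.
Qed.

(* The library norm of a matrix over [Cplx R] is an element of [Cplx R]; this
   one is real-valued and submultiplicative for all shapes. *)
Definition mnorm m n (M : 'M[C]_(m, n)) : R := \sum_i \sum_j cabs (M i j).

Section Basics.
Context {m n : nat}.
Implicit Types M : 'M[C]_(m, n).

Lemma mnorm_ge0 M : 0 <= mnorm M.
Proof. by do 2!(apply: sumr_ge0 => ? _); exact: cabs_ge0. Qed.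

Lemma cabs_le_mnorm M i j : cabs (M i j) <= mnorm M.
Proof.
rewrite /mnorm (bigD1 i) //= (bigD1 j) //= -addrA lerDl.
by rewrite addr_ge0 ?sumr_ge0 // => *; rewrite ?cabs_ge0 ?sumr_ge0 // => *;
  exact: cabs_ge0.
Qed.

Lemma mnorm0 : mnorm (0 : 'M[C]_(m, n)) = 0.
Proof. by rewrite /mnorm; do 2!(apply: big1 => ? _); rewrite mxE cabs0. Qed.

Lemma mnormD M1 M2 : mnorm (M1 + M2) <= mnorm M1 + mnorm M2.
Proof.
rewrite /mnorm -big_split; apply: ler_sum => i _; rewrite -big_split.
by apply: ler_sum => j _; rewrite mxE cabsD.
Qed.

Lemma mnormN M : mnorm (- M) = mnorm M.
Proof.
by apply: eq_bigr => i _; apply: eq_bigr => j _; rewrite mxE cabsN.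
Qed.

Lemma mnormB M1 M2 : mnorm (M1 - M2) <= mnorm M1 + mnorm M2.
Proof. by rewrite -(mnormN M2) mnormD. Qed.

Lemma mnorm_distC M1 M2 : mnorm (M1 - M2) = mnorm (M2 - M1).
Proof. by rewrite -mnormN opprB. Qed.

Lemma mnormZ (a : C) M : mnorm (a *: M) = cabs a * mnorm M.
Proof.
rewrite /mnorm mulr_sumr; apply: eq_bigr => i _; rewrite mulr_sumr.
by apply: eq_bigr => j _; rewrite mxE cabsM.
Qed.

Lemma mnorm_sum (I : Type) (r : seq I) (P : pred I) (F : I -> 'M[C]_(m, n)) :
  mnorm (\sum_(i <- r | P i) F i) <= \sum_(i <- r | P i) mnorm (F i).
Proof.
elim/big_rec2: _ => [|i y x _ le_xy]; first by rewrite mnorm0.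
exact: le_trans (mnormD _ _) (lerD _ _).
Qed.

End Basics.

Lemma mnormM m n p (M1 : 'M[C]_(m, n)) (M2 : 'M[C]_(n, p)) :
  mnorm (M1 *m M2) <= mnorm M1 * mnorm M2.
Proof.
have -> : mnorm M2 = \sum_k \sum_j cabs (M2 k j) by [].
rewrite /mnorm mulr_suml; apply: ler_sum => i _.
rewrite mulr_suml; under eq_bigr do rewrite mxE.
apply: (@le_trans _ _ (\sum_j \sum_k cabs (M1 i k * M2 k j))).
  by apply: ler_sum => j _; exact: cabs_sum.
rewrite exchange_big; apply: ler_sum => k _ /=.
under eq_bigr do rewrite cabsM.
rewrite -mulr_sumr ler_wpM2l ?cabs_ge0 // (bigD1 k) //= lerDl.
by do 2!(apply: sumr_ge0 => ? _); exact: cabs_ge0.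
Qed.

Lemma mnorm_scalar n (a : C) : mnorm (a%:M : 'M[C]_n) = n%:R * cabs a.
Proof.
rewrite /mnorm; rewrite (eq_bigr (fun=> cabs a)) => [|i _]; last first.
  rewrite (bigD1 i) //= big1 => [|j ij]; first by rewrite mxE eqxx addr0.
  by rewrite mxE eq_sym (negPf ij) cabs0.
by rewrite sumr_const card_ord mulr_natl.
Qed.

(** Link to the matrix topology of the library, in which the [limn] of [volterra_op] and [char_mx]
    is taken. *)
Lemma norm_le_mnorm m n (M : 'M[C]_(m, n)) : `|M| <= (mnorm M)%:C%C.
Proof.
change (mx_norm M <= (mnorm M)%:C%C).
have [->|/mx_norm_neq0 [i ->]] := eqVneq (mx_norm M) 0.
  by rewrite ler0c mnorm_ge0.
by rewrite normr_cabs lecR cabs_le_mnorm.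
Qed.

End EntrywiseNorm.

(** * Ultrafilter limits and absolutely convergent matrix series *)

Section Ultralimits.
Context {R : realType}.
Local Notation C := (Cplx R).
Local Open Scope classical_set_scope.

Lemma nat_ultrafilter : exists U : set_system nat, UltraFilter U /\ \oo `<=` U.
Proof. exact: ultraFilterLemma. Qed.

Section AlongUltrafilter.
Context {U : set_system nat} {UU : UltraFilter U}.

(* Ultrafilter limits stand in for completeness, for compactness of the unit
   circle and of balls, and for the extraction of diagonal subsequences. *)
Lemma ultralimit_real (u : nat -> R) (B : R) : (forall k, `|u k| <= B) ->
  exists x, forall e, 0 < e -> \forall k \near U, `|u k - x| <= e.
Proof.
move=> uB; have /= := @segment_compact R (- B) B (u @ U) _ _.
case=> [|x [_ clux]].
  by apply: filterE => k /=; rewrite in_itv /= -ler_norml.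
exists x => e e0.
(* Otherwise the complement belongs to [U], which keeps [u @ U] away from its cluster point [x]. *)
have [//|Ue] := in_ultra_setVsetC [set k | `|u k - x| <= e] UU.
have [||y []] := clux (~` [set y | `|y - x| <= e]) (ball x e) _ _.
- exact: Ue.
- exact: nbhsx_ballx.
- by move=> /= /negP; rewrite -ltNge /ball/= distrC => /ltW /le_lt_trans h /h;
    rewrite ltxx.
Qed.

Lemma ultralimit_mx m n (u : nat -> 'M[C]_(m, n)) (B : R) :
  (forall k, mnorm (u k) <= B) ->
  exists v, forall e, 0 < e -> \forall k \near U, mnorm (u k - v) <= e.
Proof.
move=> uB; have UF : Filter U by exact: filter_filter.
have /choice[re reP] (ij : 'I_m * 'I_n) : exists x, forall e, 0 < e ->
    \forall k \near U, `|complex.Re (u k ij.1 ij.2) - x| <= e.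
  apply: (@ultralimit_real _ B) => k.
  exact: le_trans (Re_le_cabs _) (le_trans (cabs_le_mnorm _ _ _) (uB k)).
have /choice[im imP] (ij : 'I_m * 'I_n) : exists x, forall e, 0 < e ->
    \forall k \near U, `|complex.Im (u k ij.1 ij.2) - x| <= e.
  apply: (@ultralimit_real _ B) => k.
  exact: le_trans (Im_le_cabs _) (le_trans (cabs_le_mnorm _ _ _) (uB k)).
exists (\matrix_(i, j) ((re (i, j) +i* im (i, j))%C : C)) => e e0.
(* Each of the m n entries has a real and an imaginary part, each to be within e/c; the added 1
   keeps [c] positive for empty matrices. *)
pose c : R := m%:R * (n%:R * 2) + 1.
have c0 : 0 < c by rewrite ltr_wpDl ?mulr_ge0.
have := @filter_forall _ _ (fun ij k =>
  `|complex.Re (u k ij.1 ij.2) - re ij| <= e / c) U UF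
  (fun ij => reP ij _ (divr_gt0 e0 c0)).
have := @filter_forall _ _ (fun ij k =>
  `|complex.Im (u k ij.1 ij.2) - im ij| <= e / c) U UF
  (fun ij => imP ij _ (divr_gt0 e0 c0)).
apply: filterS2 => k /= imk rek.
have -> : e = m%:R * (n%:R * 2) * (e / c) + e / c.
  by rewrite -[X in _ + X]mul1r -mulrDl mulrC divfK // gt_eqF.
apply: (@le_trans _ _ (m%:R * (n%:R * 2) * (e / c))); last first.
  by rewrite lerDl divr_ge0 // ltW.
have bnd : \sum_(i < m) \sum_(j < n) (2 * (e / c)) =
    m%:R * (n%:R * 2) * (e / c).
  by rewrite !sumr_const !card_ord; lra.
rewrite -bnd; apply: ler_sum => i _; apply: ler_sum => j _.
apply: le_trans (cabs_ReIm _) _; rewrite !mxE mulr_natl mulr2n.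
move: (rek (i, j)) (imk (i, j)) => /=; case: (u k i j) => a b /= ra ib.
exact: lerD.
Qed.

Lemma ultralimit_le m n (u : nat -> 'M[C]_(m, n)) (v w : 'M[C]_(m, n)) (c : R) :
  (forall e, 0 < e -> \forall k \near U, mnorm (u k - v) <= e) ->
  (\forall k \near U, mnorm (u k - w) <= c) -> mnorm (v - w) <= c.
Proof.
move=> uv uw; apply/ler_addgt0Pr => e e0.
have [k [/= ukw ukv]] := filter_ex (filterI uw (uv e e0)).
rewrite (_ : v - w = (u k - w) - (u k - v)); last first.
  by rewrite opprB [RHS]addrC addrA subrK.
exact: le_trans (mnormB _ _) (lerD _ _).
Qed.

End AlongUltrafilter.

(** Convergence is measured by the real-valued [mnorm], so that estimates stay in [R];
    [msum_to_limn] recovers the limit in the library topology. *)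
Definition msum_to m n (u : nat -> 'M[C]_(m, n)) (S : 'M[C]_(m, n)) : Prop :=
  (fun k => mnorm (S - series u k)) @ \oo --> (0 : R).

Lemma msum_to_limn m n (u : nat -> 'M[C]_(m, n)) S :
  msum_to u S -> limn (series u) = S.
Proof.
move=> uS; apply: cvg_lim; first exact: norm_hausdorff.
apply/cvgrPdist_le => e e0.
(* A positive element of [Cplx R] is real. *)
have er : e = (complex.Re e)%:C%C by rewrite RRe_real // gtr0_real.
have re0 : 0 < complex.Re e by move: e0; rewrite {1}er ltcR.
move/cvgr0Pnorm_le : uS => /(_ _ re0); apply: filterS => k.
rewrite ger0_norm ?mnorm_ge0 // => h.
by apply: le_trans (norm_le_mnorm _) _; rewrite er lecR.
Qed.

Lemma msum_to_ext m n (u v : nat -> 'M[C]_(m, n)) S T :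
  msum_to u S -> u =1 v -> S = T -> msum_to v T.
Proof. by move=> uS /funext <- <-. Qed.

Lemma msum_to_uniq m n (u : nat -> 'M[C]_(m, n)) S T :
  msum_to u S -> msum_to u T -> S = T.
Proof. by move=> /msum_to_limn <- /msum_to_limn <-. Qed.

(** The sum is the ultralimit of the partial sums. The tail estimate depends on [b] alone, hence is
    uniform over all series dominated by [b], as the passage to the limit in [bounded_solution]
    requires. *)
Lemma dominated_msum m n (u : nat -> 'M[C]_(m, n)) (b : nat -> R) :
  (forall j, mnorm (u j) <= b j) -> cvgn (series b) ->
  exists S, forall k, mnorm (S - series u k) <= limn (series b) - series b k.
Proof.
move=> ub cb; have [U [UU ooU]] := nat_ultrafilter.
have b0 j : 0 <= b j by exact: le_trans (mnorm_ge0 _) (ub j).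
have bnd := nondecreasing_cvgn_le (nondecreasing_series (fun j _ _ => b0 j)) cb.
have part k l : (k <= l)%N ->
    mnorm (series u l - series u k) <= limn (series b) - series b k.
  move=> kl; apply: (@le_trans _ _ (series b l - series b k)).
    rewrite !sub_series_geq //; apply: le_trans (mnorm_sum _ _ _) _.
    exact: ler_sum.
  by rewrite lerD2r; exact: bnd.
have [|S uS] := @ultralimit_mx U UU _ _ (series u) (limn (series b)).
  move=> k; have := part 0%N k (leq0n k).
  have s0 (V : zmodType) (f : nat -> V) : series f 0 = 0.
    by rewrite /series /= big_geq.
  by rewrite !s0 !subr0.
exists S => k; apply: ultralimit_le uS _.
by apply: ooU; exists k => // l kl; exact: part.
Qed.

Lemma tail_msum_to m n (u : nat -> 'M[C]_(m, n)) (b : nat -> R) S (c : R) :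
  cvgn (series b) ->
  (forall k, mnorm (S - series u k) <= c * (limn (series b) - series b k)) ->
  msum_to u S.
Proof.
move=> cb uS; apply: squeeze_cvgr (cvg_cst _) _.
  by apply: nearW => k; rewrite mnorm_ge0; exact: uS.
rewrite -[X in _ --> X](mulr0 c) -[X in c * X](subrr (limn (series b))).
by apply: cvgMr; apply: cvgB => //; exact: cvg_cst.
Qed.

Lemma msum_to_ex m n (u : nat -> 'M[C]_(m, n)) (b : nat -> R) :
  (forall j, mnorm (u j) <= b j) -> cvgn (series b) -> exists S, msum_to u S.
Proof.
move=> ub cb; have [S uS] := dominated_msum ub cb.
by exists S; apply: (@tail_msum_to _ _ _ b _ 1) => // k; rewrite mul1r.
Qed.

Lemma msum_to_lin m n p q (f : {additive 'M[C]_(m, n) -> 'M[C]_(p, q)}) (c : R)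
    (u : nat -> 'M[C]_(m, n)) S :
  (forall x, mnorm (f x) <= c * mnorm x) ->
  msum_to u S -> msum_to (f \o u) (f S).
Proof.
move=> fc uS; apply: (@squeeze_cvgr _ _ _ _ (fun=> 0)
  (fun k => c * mnorm (S - series u k))) (cvg_cst _) _.
  apply: nearW => k; rewrite mnorm_ge0 /=.
  suff -> : f S - series (f \o u) k = f (S - series u k) by exact: fc.
  by rewrite [RHS]raddfB /series /= (raddf_sum f).
by rewrite -[X in _ --> X](mulr0 c); apply: cvgMr.
Qed.

Lemma msum_toD m n (u v : nat -> 'M[C]_(m, n)) S T :
  msum_to u S -> msum_to v T -> msum_to (fun j => u j + v j) (S + T).
Proof.
move=> uS vT; apply: (@squeeze_cvgr _ _ _ _ (fun=> 0)
  (fun k => mnorm (S - series u k) + mnorm (T - series v k))) (cvg_cst _) _.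
  apply: nearW => k; rewrite mnorm_ge0 /= (_ : _ - _ =
    (S - series u k) + (T - series v k)) ?mnormD //.
  by rewrite /series /= big_split /= opprD addrACA.
by rewrite -[X in _ --> X](addr0 0); apply: cvgD.
Qed.

Lemma msum_toZ m n (a : C) (u : nat -> 'M[C]_(m, n)) S :
  msum_to u S -> msum_to (fun j => a *: u j) (a *: S).
Proof.
by apply: (@msum_to_lin _ _ _ _ ( *:%R a) (cabs a)) => x; rewrite mnormZ.
Qed.

Lemma msum_toMr m n p (M : 'M[C]_(n, p)) (u : nat -> 'M[C]_(m, n)) S :
  msum_to u S -> msum_to (fun j => u j *m M) (S *m M).
Proof.
apply: (@msum_to_lin _ _ _ _ (mulmxr M) (mnorm M)) => x /=.
by rewrite mulrC; exact: mnormM.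
Qed.

Lemma msum_toB m n (u v : nat -> 'M[C]_(m, n)) S T :
  msum_to u S -> msum_to v T -> msum_to (fun j => u j - v j) (S - T).
Proof.
move=> uS /(msum_toZ (-1)) /(msum_toD uS) /msum_to_ext; apply.
  by move=> j; rewrite scaleN1r.
by rewrite scaleN1r.
Qed.

Lemma msum_to_sum m n (I : Type) (r : seq I) (u : I -> nat -> 'M[C]_(m, n)) S :
  (forall i, msum_to (u i) (S i)) ->
  msum_to (fun j => \sum_(i <- r) u i j) (\sum_(i <- r) S i).
Proof.
move=> uS; elim: r => [|i r IH].
  rewrite big_nil; apply: (@tail_msum_to _ _ _ (fun=> 0) _ 0) => [|k].
    by apply: is_cvg_near_cst; apply: nearW => k; rewrite /series /= big1.
  by rewrite mul0r sub0r mnormN /series /= big1 ?mnorm0 // => j _;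
    rewrite big_nil.
rewrite big_cons; apply: msum_to_ext (msum_toD (uS i) IH) _ _ => // j.
by rewrite big_cons.
Qed.

Lemma msum_to_le m n (u : nat -> 'M[C]_(m, n)) S (B : R) :
  msum_to u S -> (forall k, \sum_(0 <= j < k) mnorm (u j) <= B) -> mnorm S <= B.
Proof.
move=> uS uB; apply/ler_addgt0Pr => e e0.
move/cvgr0Pnorm_le : uS => /(_ _ e0) /filter_ex [k /=].
rewrite ger0_norm ?mnorm_ge0 // => Sk.
rewrite -(subrK (series u k) S) addrC; apply: le_trans (mnormD _ _) (lerD _ Sk).
exact: le_trans (mnorm_sum _ _ _) (uB k).
Qed.

End Ultralimits.

(** * The unit circle *)

Section UnitCircle.
Context {R : realType}.
Local Notation C := (Cplx R).
Implicit Types s t x : R.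

Lemma sin_mvt x : 0 < x -> exists2 c, 0 < c < x & sin x = cos c * x.
Proof.
move=> x0; have [|c] := @MVT R sin cos 0 x x0.
  by apply: continuous_subspaceT; exact: continuous_sin.
by rewrite in_itv /= sin0 !subr0 => ? ?; exists c.
Qed.

Lemma sin_sqr_le x : sin x ^+ 2 <= x ^+ 2.
Proof.
wlog x0 : x / 0 < x => [wlg|].
  have [x0|x0|->] := ltgtP x 0; last by rewrite sin0.
    by rewrite -(sqrrN x) -(sqrrN (sin x)) -sinN wlg // oppr_gt0.
  exact: wlg.
have [c _ ->] := sin_mvt x0.
rewrite exprMn -[leRHS]mul1r; apply: ler_wpM2r; first exact: sqr_ge0.
by rewrite -real_normK ?num_real // expr_le1 // cos_max.
Qed.

(** Halving the angle gives sin x = x cos(x/2) cos c with 0 < c < x/2, which is at least x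
    cos(x/2)^2 = x (1 + cos x) / 2. *)
Lemma sin_ge_half x : 0 <= x <= pi / 2 -> x / 2 <= sin x.
Proof.
move=> /andP[]; rewrite le_eqVlt => /orP[/eqP <-|x0 xpi].
  by rewrite mul0r sin0.
have cosx : 0 <= cos x.
  by apply: cos_ge0_pihalf; rewrite xpi andbT; have := @pi_gt0 R; lra.
have y0 : 0 < x / 2 by rewrite divr_gt0.
have [c /andP[c0 cy] sy] := sin_mvt y0.
have ccos : cos (x / 2) <= cos c.
  by rewrite ltW // ltr_cos // in_itv /=; lra.
have y1 : 0 <= cos (x / 2) by apply: cos_ge0_pihalf; lra.
have xE : x = x / 2 *+ 2 by rewrite -mulr_natr divfK.
have cosE : cos x = cos (x / 2) ^+ 2 *+ 2 - 1 by rewrite {1}xE cos_mulr2n.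
have -> : sin x = cos (x / 2) * cos c * x.
  by rewrite {1}xE sin_mulr2n sy; lra.
have : cos (x / 2) ^+ 2 <= cos (x / 2) * cos c by rewrite expr2 ler_wpM2l.
by nra.
Qed.

Definition cis t : C := (cos t +i* sin t)%C.

Lemma cis0 : cis 0 = 1.
Proof. by rewrite /cis cos0 sin0. Qed.

Lemma cisD s t : cis (s + t) = cis s * cis t.
Proof. by rewrite /cis cosD sinD; congr (_ +i* _)%C; rewrite addrC mulrC. Qed.

Lemma cabs_cis t : cabs (cis t) = 1.
Proof. by rewrite /cabs /cis /= cos2Dsin2 sqrtr1. Qed.

Lemma cis_neq0 t : cis t != 0.
Proof. by apply/eqP => /(congr1 cabs); rewrite cabs_cis cabs0; lra. Qed.

Lemma cisN t : cis (- t) = (cis t)^-1.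
Proof.
by apply: (mulfI (cis_neq0 t)); rewrite -cisD subrr cis0 divff ?cis_neq0.
Qed.

Lemma cisX t n : cis (n%:R * t) = cis t ^+ n.
Proof.
elim: n => [|n IH]; first by rewrite mul0r cis0 expr0.
by rewrite -natr1 mulrDl mul1r cisD IH exprSr.
Qed.

Lemma cis_2pi : cis (pi *+ 2) = 1.
Proof. by rewrite /cis cos2pi sin2pi. Qed.

Lemma cis_periodic (p : int) : cis (p%:~R * (pi *+ 2)) = 1.
Proof.
case: p => n; first by rewrite cisX cis_2pi expr1n.
by rewrite NegzE mulrNz mulNr cisN cisX cis_2pi expr1n invr1.
Qed.

Lemma cis_diff2 t :
  cis t + cis (- t) - 2 = (- (4 * sin (t / 2) ^+ 2))%:C%C :> C.
Proof.
have tE : t = t / 2 *+ 2 by rewrite -mulr_natr divfK.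
rewrite /cis cosN sinN; apply/eqP; rewrite eq_complex /=; apply/andP; split.
  by rewrite {1 2}tE cos_mulr2n cos2sin2; apply/eqP; lra.
by apply/eqP; lra.
Qed.

Lemma cabs_cis_diff2 t : cabs (cis t + cis (- t) - 2) = 4 * sin (t / 2) ^+ 2.
Proof.
by rewrite cis_diff2 cabs_real normrN ger0_norm // mulr_ge0 ?sqr_ge0.
Qed.

Lemma cabs_cis_diff2_le t : cabs (cis t + cis (- t) - 2) <= t ^+ 2.
Proof. by rewrite cabs_cis_diff2; have := sin_sqr_le (t / 2); lra. Qed.

(** Since (cis t - 1)^2 = cis t (cis t + cis(-t) - 2), the squared modulus is that of a second
    difference. *)
Lemma cabs_cisB1 t : cabs (cis t - 1) <= `|t|.
Proof.
rewrite -(ler_pXn2r (ltn0Sn 1)) ?nnegrE ?cabs_ge0 // real_normK ?num_real //.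
apply: le_trans (cabs_cis_diff2_le t).
rewrite expr2 -cabsM (_ : _ * _ = cis t * (cis t + cis (- t) - 2)).
  by rewrite cabsM cabs_cis mul1r.
have : cis t * cis (- t) = 1 by rewrite -cisD subrr cis0.
by move=> h; rewrite [RHS]mulrBr [X in _ = X - _]mulrDr h; ring.
Qed.

(** Here s = 2 pi / M and 4 sin(ms/2)^2 = |e^{ims} - 1|^2. If ms <= pi, [sin_ge_half] gives
    sin(ms/2) >= ms/4; otherwise m is reflected to M - m. The sum of both inverse squares covers
    both cases. *)
Lemma root_gap (M m : nat) s : (0 < m < M)%N -> M%:R * s = pi *+ 2 ->
  s ^+ 2 <= 4 * (4 * sin (m%:R * s / 2) ^+ 2)
              * (m%:R ^- 2 + (M - m)%N%:R ^- 2).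
Proof.
move=> /andP[m0 mM] MsE; have M0 : (0 < M)%N by exact: ltn_trans m0 mM.
have s0 : 0 < s.
  by rewrite -(@pmulr_rgt0 _ M%:R) ?ltr0n // MsE mulrn_wgt0 ?pi_gt0.
have c0 x : 0 <= 4 * (4 * sin x ^+ 2) by have := sqr_ge0 (sin x); lra.
have key (k : nat) : (0 < k)%N -> k%:R * s <= pi ->
    s ^+ 2 <= 4 * (4 * sin (k%:R * s / 2) ^+ 2) * k%:R ^- 2.
  move=> k0 ks; have kR : 0 < k%:R :> R by rewrite ltr0n.
  rewrite -ler_pdivrMr ?invr_gt0 ?exprn_gt0 // invrK -exprMn.
  have ks0 : 0 <= k%:R * s by rewrite mulr_ge0 // ltW.
  have : k%:R * s / 2 / 2 <= sin (k%:R * s / 2).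
    by apply: sin_ge_half; apply/andP; split; lra.
  by rewrite mulrC; nra.
have [h|h] := lerP (m%:R * s) pi.
  apply: le_trans (key m m0 h) _.
  by rewrite ler_wpM2l ?c0 // lerDl invr_ge0 exprn_ge0.
have mE : m%:R * s = pi *+ 2 - (M - m)%N%:R * s.
  by rewrite natrB ?(ltnW mM) // mulrBl MsE subKr.
have -> : sin (m%:R * s / 2) = sin ((M - m)%N%:R * s / 2).
  rewrite mE (_ : _ / 2 = - ((M - m)%N%:R * s / 2) + pi); last by lra.
  by rewrite sinDpi sinN opprK.
apply: le_trans (key (M - m)%N _ _) _; first by rewrite subn_gt0.
  by move: mE; lra.
by rewrite ler_wpM2l ?c0 // lerDr invr_ge0 exprn_ge0.
Qed.

Lemma sum_inv_sqr_le n : \sum_(1 <= k < n) (k%:R ^- 2 : R) <= 2.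
Proof.
case: n => [|[|n]]; [by rewrite big_geq|by rewrite big_geq|].
(* The induction runs on a sharper bound, whose increment 1/((n+1)(n+2)) exceeds 1/(n+2)^2. *)
suff h : \sum_(1 <= k < n.+2) (k%:R ^- 2 : R) <= 2 - n.+1%:R^-1.
  by apply: le_trans h _; rewrite gerBl invr_ge0.
elim: n => [|n IH]; first by rewrite big_nat1; lra.
rewrite big_nat_recr //=; apply: le_trans (lerD IH (lexx _)) _.
have a0 : 0 < n.+1%:R :> R by rewrite ltr0n.
have -> : n.+2%:R = n.+1%:R + 1 :> R by rewrite -natr1.
move: (n.+1%:R) a0 => a a0; have b0 : 0 < a + 1 by rewrite addr_gt0.
rewrite -subr_ge0 (_ : _ - _ = a^-1 * (a + 1) ^- 2); last first.
  by field; rewrite !gt_eqF.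
by rewrite mulr_ge0 // invr_ge0 ?exprn_ge0 // ltW.
Qed.

End UnitCircle.

(** * The characteristic matrix on the unit circle *)

Section Symbol.
Context {R : realType} {d : nat}.
Local Notation C := (Cplx R).
Variable A : nat -> 'M[C]_d.
Local Open Scope classical_set_scope.

(** The factor (1 + j)^2 dominates 1, j and j^2, so one weight serves the series, its first
    differences and its second differences in the angle. *)
Let w (j : nat) : R := (1 + j%:R) ^+ 2 * mnorm (A j).
Hypothesis cvgw : cvgn (series w).

Let w_ge0 j : 0 <= w j.
Proof. by rewrite mulr_ge0 ?sqr_ge0 ?mnorm_ge0. Qed.

(** The summand d is the entrywise norm of the unit matrix and accounts for the term lambda E of
    Delta. *)
Let mass : R := d%:R + limn (series w).

Let wsum k : \sum_(0 <= j < k) w j <= limn (series w).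
Proof.
exact: (nondecreasing_cvgn_le (nondecreasing_series (fun j _ _ =>
  w_ge0 j)) cvgw).
Qed.

Let limw_ge0 : 0 <= limn (series w).
Proof. by have := wsum 0; rewrite big_geq. Qed.

Let mass_ge0 : 0 <= mass.
Proof. by rewrite addr_ge0. Qed.

Let mnormA_le j : mnorm (A j) <= w j.
Proof.
rewrite -[leLHS]mul1r ler_wpM2r ?mnorm_ge0 //.
by rewrite exprn_ege1 // lerDl.
Qed.

Definition symbol (t : R) : 'M[C]_d := char_mx A (cis t).

Lemma char_mx_msum (lambda : C) : cabs lambda = 1 ->
  msum_to (fun j => lambda ^- j *: A j) (lambda%:M - char_mx A lambda).
Proof.
move=> l1; have [|S uS] := @msum_to_ex R _ _ (fun j =>
  lambda ^- j *: A j) w _ cvgw.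
  by move=> j; rewrite mnormZ cabsV cabsX l1 expr1n invr1 mul1r.
have -> : lambda%:M - char_mx A lambda = S; last by [].
by rewrite /char_mx opprB addrCA subrr addr0 (msum_to_limn uS).
Qed.

Lemma symbol_msum t :
  msum_to (fun j => cis (- (j%:R * t)) *: A j) ((cis t)%:M - symbol t).
Proof.
apply: msum_to_ext (char_mx_msum (cabs_cis t)) _ _ => // j.
by rewrite cisN cisX.
Qed.

Let msum_weighted (u : nat -> 'M[C]_d) S (c : R) :
  msum_to u S -> 0 <= c -> (forall j, mnorm (u j) <= c * w j) ->
  mnorm S <= c * limn (series w).
Proof.
move=> uS c0 uw; apply: msum_to_le uS _ => k.
apply: (@le_trans _ _ (c * \sum_(0 <= j < k) w j)); last by rewrite ler_wpM2l.
by rewrite mulr_sumr; apply: ler_sum.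
Qed.

(** Termwise, |e^{-ijs} - 1| <= j |s| <= (1 + j)^2 |s|. *)
Lemma symbol_lip t s : mnorm (symbol (t + s) - symbol t) <= mass * `|s|.
Proof.
have := msum_toB (symbol_msum (t + s)) (symbol_msum t).
set u := (X in msum_to X); set S := (X in msum_to _ X) => uS.
have -> : symbol (t + s) - symbol t = (cis t * (cis s - 1))%:M - S.
  rewrite /S mulrBr mulr1 -cisD; move: (symbol (t + s)) (symbol t) => P Q.
  by apply/matrixP => i j; rewrite !mxE mulrnBl; ring.
rewrite /mass mulrDl; apply: le_trans (mnormB _ _) (lerD _ _).
  by rewrite mnorm_scalar cabsM cabs_cis mul1r ler_wpM2l ?cabs_cisB1.
rewrite mulrC; apply: msum_weighted uS _ _ => // j.
rewrite /u -scalerBl mnormZ.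
have -> : cis (- (j%:R * (t + s))) - cis (- (j%:R * t)) =
    cis (- (j%:R * t)) * (cis (- (j%:R * s)) - 1).
  by rewrite mulrBr mulr1 -cisD mulrDr opprD.
rewrite cabsM cabs_cis mul1r /w mulrA ler_wpM2r ?mnorm_ge0 //.
apply: le_trans (cabs_cisB1 _) _; rewrite normrN normrM mulrC.
rewrite ler_wpM2l // ger0_norm //.
by have : (0 : R) <= j%:R by []; nra.
Qed.

(** Termwise, the second difference of e^{-ijt} is e^{-ijt} (e^{-ijs} + e^{ijs} - 2), of modulus at
    most (js)^2. *)
Lemma symbol_diff2 t s :
  mnorm (symbol (t + s) + symbol (t - s) - 2 *: symbol t) <= mass * s ^+ 2.
Proof.
have := msum_toB (msum_toD (symbol_msum (t + s)) (symbol_msum (t - s)))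
  (msum_toZ 2 (symbol_msum t)).
set u := (X in msum_to X); set S := (X in msum_to _ X) => uS.
have -> : symbol (t + s) + symbol (t - s) - 2 *: symbol t =
    (cis t * (cis s + cis (- s) - 2))%:M - S.
  rewrite /S mulrBr mulrDr -!cisD.
  move: (symbol (t + s)) (symbol (t - s)) (symbol t) => P Q Q'.
  apply/matrixP => i j; rewrite !mxE.
  by case: (i == j); rewrite ?mulr1n ?mulr0n; ring.
rewrite /mass mulrDl; apply: le_trans (mnormB _ _) (lerD _ _).
  by rewrite mnorm_scalar cabsM cabs_cis mul1r ler_wpM2l ?cabs_cis_diff2_le.
rewrite mulrC; apply: msum_weighted uS _ _ => [|j]; first exact: sqr_ge0.
have -> : u j = (cis (- (j%:R * t)) *
    (cis (- (j%:R * s)) + cis (- - (j%:R * s)) - 2)) *: A j.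
  have e1 : - (j%:R * (t + s)) = - (j%:R * t) + - (j%:R * s) by ring.
  have e2 : - (j%:R * (t - s)) = - (j%:R * t) + - - (j%:R * s) by ring.
  rewrite /u e1 e2 !cisD scalerA -scalerDl -scalerBl.
  by congr (_ *: _); ring.
rewrite mnormZ cabsM cabs_cis mul1r /w mulrA ler_wpM2r ?mnorm_ge0 //.
apply: le_trans (cabs_cis_diff2_le _) _; rewrite sqrrN exprMn mulrC.
rewrite ler_wpM2l ?sqr_ge0 //.
by have : (0 : R) <= j%:R by []; nra.
Qed.

Hypothesis symbol_unit : forall t, symbol t \in unitmx.

Let H t := invmx (symbol t).

Lemma invmx_sub n (P Q : 'M[C]_n) : P \in unitmx -> Q \in unitmx ->
  invmx P - invmx Q = invmx P *m (Q - P) *m invmx Q.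
Proof.
by move=> Pu Qu; rewrite mulmxBr mulVmx // mulmxBl mul1mx -mulmxA mulmxV //
  mulmx1.
Qed.

Let HB v t : H v - H t = H v *m (symbol t - symbol v) *m H t.
Proof. exact: invmx_sub. Qed.

Let half (a b : R) : a <= a / 2 + b -> a <= 2 * b.
Proof. by lra. Qed.

(** If |H(t_k)| > k, let x be an ultralimit of the t_k. In H(t_k) = H(t_k) (Delta(x) - Delta(t_k))
    H(x) + H(x), with Delta taken at the angle, the first term is eventually at most half of
    |H(t_k)|, so |H(t_k)| <= 2 |H(x)|, a contradiction. *)
Lemma invmx_symbol_bounded b :
  exists2 K, 0 <= K & forall t, `|t| <= b -> mnorm (H t) <= K.
Proof.
apply: contrapT => unb.
have /choice[t tP] (k : nat) : exists t, `|t| <= b /\ k%:R < mnorm (H t).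
  apply: contrapT => nex; apply: unb; exists k%:R => // t tb.
  by rewrite leNgt; apply/negP => kt; apply: nex; exists t.
have [U [UU ooU]] := nat_ultrafilter.
have [x tx] := @ultralimit_real R U UU t b (fun k => (tP k).1).
(* Chosen so that mass * e * |H(x)| <= 1/2. *)
pose e := (2 * (mnorm (H x) * mass + 1))^-1.
have c0 : 0 < mnorm (H x) * mass + 1.
  by rewrite ltr_wpDl ?mulr_ge0 ?mnorm_ge0.
have e0 : 0 < e by rewrite invr_gt0 mulr_gt0.
have far : \forall k \near U, 2 * mnorm (H x) <= k%:R.
  exact: ooU (nbhs_infty_ger _).
have [k [/= tk kH]] := filter_ex (filterI (tx e e0) far).
have [_ kt] := tP k; move: kt; apply/negP; rewrite -leNgt; apply: le_trans _ kH.
have tE : H (t k) = H (t k) *m (symbol x - symbol (t k)) *m H x + H x.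
  by rewrite -HB subrK.
have close : mnorm (symbol x - symbol (t k)) * mnorm (H x) <= 2^-1.
  have lip := symbol_lip x (t k - x); rewrite [x + _]addrC subrK in lip.
  rewrite mnorm_distC.
  apply: (@le_trans _ _ (mass * e * mnorm (H x))).
    rewrite ler_wpM2r ?mnorm_ge0 //; apply: le_trans lip _.
    exact: ler_wpM2l.
  rewrite mulrAC ler_pdivrMr ?mulr_gt0 // mulKf ?pnatr_eq0 //.
  by rewrite [mass * _]mulrC lerDl.
apply: half; rewrite {1}tE; apply: le_trans (mnormD _ _) _;
  rewrite lerD2r -mulmxA.
  apply: le_trans (mnormM _ _) _; rewrite ler_wpM2l ?mnorm_ge0 //.
  exact: le_trans (mnormM _ _) close.
Qed.

(** Second-order form of the resolvent identity, with P', Q', S' in the role of the inverses of P,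
    Q, S: one term contains the second difference, the other a product of two first differences, so
    both are O(s^2). *)
Let inv_diff2 (P Q S P' Q' S' : 'M[C]_d) :
  P' - S' = P' *m (S - P) *m S' -> Q' - S' = Q' *m (S - Q) *m S' ->
  P' + Q' - 2 *: S' =
    - (P' *m (P + Q - 2 *: S) *m S') + (Q' - P') *m (S - Q) *m S'.
Proof.
move=> hP hQ; have -> : P' + Q' - 2 *: S' = (P' - S') + (Q' - S').
  by apply/matrixP => i j; rewrite !mxE; ring.
rewrite hP hQ (_ : P + Q - 2 *: S = - ((S - P) + (S - Q))); last first.
  by apply/matrixP => i j; rewrite !mxE; ring.
move: (S - P) (S - Q) => X Y.
by rewrite mulmxN mulNmx opprK mulmxDr !mulmxDl !mulNmx [RHS]addrACA subrr
  addr0.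
Qed.

Lemma invmx_symbol_diff2 b : exists2 K, 0 <= K &
  forall t s, `|t| <= b -> `|t + s| <= b -> `|t - s| <= b ->
  mnorm (H (t + s) + H (t - s) - 2 *: H t) <= K * s ^+ 2.
Proof.
have [K K0 HK] := invmx_symbol_bounded b.
(* The two summands match the two terms of [inv_diff2]; the 2 arises because t + s and t - s are 2s
   apart. *)
exists (K * mass * K + K * (mass * 2) * K * (mass * K)) => [|t s tb tsb tsb'].
  by rewrite addr_ge0 // !mulr_ge0.
have -> : H (t + s) + H (t - s) - 2 *: H t =
    - (H (t + s) *m (symbol (t + s) + symbol (t - s) - 2 *: symbol t) *m H t)
    + (H (t - s) - H (t + s)) *m (symbol t - symbol (t - s)) *m H t.
  by apply: inv_diff2; exact: HB.
rewrite mulrDl; apply: le_trans (mnormD _ _) (lerD _ _).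
  rewrite mnormN; apply: le_trans (mnormM _ _) _.
  rewrite [_ * K * _]mulrAC ler_pM ?mnorm_ge0 ?HK //.
  apply: le_trans (mnormM _ _) _; rewrite -mulrA ler_pM ?mnorm_ge0 ?HK //.
  exact: symbol_diff2.
have -> : K * (mass * 2) * K * (mass * K) * s ^+ 2 =
    (K * (mass * `|s *+ 2|) * K) * (mass * `|s|) * K.
  rewrite normrMn -mulr_natr -real_normK ?num_real //; ring.
apply: le_trans (mnormM _ _) _; rewrite ler_pM ?mnorm_ge0 ?HK //.
apply: le_trans (mnormM _ _) _; rewrite ler_pM ?mnorm_ge0 //; last first.
  by have := symbol_lip (t - s) s; rewrite subrK.
rewrite HB.
apply: le_trans (mnormM _ _) _; rewrite ler_pM ?mnorm_ge0 ?HK //.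
apply: le_trans (mnormM _ _) _; rewrite ler_pM ?mnorm_ge0 ?HK //.
rewrite (_ : t + s = t - s + s *+ 2) ?symbol_lip // mulr2n.
by rewrite addrA subrK.
Qed.

End Symbol.

(** * Periodic Green functions *)

Section PeriodicGreen.
Context {R : realType} {d : nat}.
Local Notation C := (Cplx R).
Variables (H : R -> 'M[C]_d) (M : nat) (s : R).
Hypothesis H_periodic : forall t, H (t + pi *+ 2) = H t.
Hypothesis M_gt0 : (0 < M)%N.
Hypothesis Ms : M%:R * s = pi *+ 2.

Let s_gt0 : 0 < s.
Proof. by rewrite -(@pmulr_rgt0 _ M%:R) ?ltr0n // Ms mulrn_wgt0 ?pi_gt0. Qed.

(** The difference of the two sums telescopes to F(2 pi) - F(0). *)
Let sum_shift (V : zmodType) (F : R -> V) : F (pi *+ 2) = F 0 ->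
  \sum_(k < M) F (k%:R * s + s) = \sum_(k < M) F (k%:R * s).
Proof.
move=> F2; have E k : F (k%:R * s + s) = F (k.+1%:R * s).
  by rewrite -natr1 mulrDl mul1r.
under eq_bigr do rewrite E.
apply/eqP; rewrite -subr_eq0 -sumrB -(big_mkord xpredT (fun k =>
  F (k.+1%:R * s) - F (k%:R * s))) (telescope_sumr (fun k => F (k%:R * s))) //.
by rewrite Ms mul0r F2 subrr.
Qed.

(* The periodic Green function, for H t = Delta(e^{it})^-1. *)
Definition green (p : int) : 'M[C]_d := (M%:R^-1 : C) *:
  \sum_(k < M) cis (p%:~R * (k%:R * s)) *: H (k%:R * s).

Lemma green_period p : green (p + M%:Z) = green p.
Proof.
congr (_ *: _); apply: eq_bigr => k _; congr (_ *: _).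
rewrite intrD mulrDl [X in cis (_ + X)]mulrCA.
rewrite (_ : (M%:Z)%:~R * s = pi *+ 2); last exact: Ms.
by rewrite cisD (cis_periodic k) mulr1.
Qed.

Let cabs_Minv : cabs (M%:R^-1 : C) = M%:R^-1.
Proof.
by rewrite cabsV -(rmorph_nat (real_complex R)) cabs_real ger0_norm.
Qed.

Let avg_le (F : nat -> 'M[C]_d) (c : R) :
  (forall k, (k < M)%N -> mnorm (F k) <= c) ->
  mnorm ((M%:R^-1 : C) *: \sum_(k < M) F k) <= c.
Proof.
move=> Fc; rewrite mnormZ cabs_Minv mulrC ler_pdivrMr ?ltr0n //.
apply: le_trans (mnorm_sum _ _ _) _.
apply: (@le_trans _ _ (\sum_(k < M) c)).
  by apply: ler_sum => k _; exact: Fc.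
by rewrite sumr_const card_ord mulr_natr.
Qed.

Let ks_le (k : nat) : (k < M)%N -> k%:R * s <= pi *+ 2.
Proof. by move=> kM; rewrite -Ms ler_wpM2r ?(ltW s_gt0) // ler_nat ltnW. Qed.

Let s_le : s <= pi *+ 2.
Proof. by rewrite -Ms ler_peMl ?ler1n // (ltW s_gt0). Qed.

Lemma green_le K : (forall t, `|t| <= pi *+ 4 -> mnorm (H t) <= K) ->
  forall p, mnorm (green p) <= K.
Proof.
move=> HK p.
apply: (@avg_le (fun k => cis (p%:~R * (k%:R * s)) *: H (k%:R * s))) => k kM.
rewrite mnormZ cabs_cis mul1r HK //.
rewrite ger0_norm ?mulr_ge0 ?(ltW s_gt0) //; apply: le_trans (ks_le kM) _.
by have := @pi_ge0 R; lra.
Qed.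

(* Summation by parts, twice: shifting the index k by 1 and by -1 multiplies
   the sum defining [green p] by e^{-ips} and by e^{ips}. *)
Lemma green_diff2 K :
  (forall t s, `|t| <= pi *+ 4 -> `|t + s| <= pi *+ 4 -> `|t - s| <= pi *+ 4 ->
    mnorm (H (t + s) + H (t - s) - 2 *: H t) <= K * s ^+ 2) ->
  forall p : int, 4 * sin (p%:~R * s / 2) ^+ 2 * mnorm (green p) <= K * s ^+ 2.
Proof.
move=> HK p; rewrite -cabs_cis_diff2 -mnormZ.
pose F t := cis (p%:~R * t) *: H t.
have F2 t : F (t + pi *+ 2) = F t.
  by rewrite /F H_periodic mulrDr cisD cis_periodic mulr1.
have F0 : F (pi *+ 2) = F 0 by rewrite -[pi *+ 2]add0r F2.
have up : \sum_(k < M) cis (p%:~R * (k%:R * s)) *: H (k%:R * s + s) =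
    cis (- (p%:~R * s)) *: \sum_(k < M) F (k%:R * s).
  rewrite -(sum_shift F0) scaler_sumr.
  apply: eq_bigr => k _; rewrite /F scalerA -cisD; congr (cis _ *: _).
  by rewrite mulrDr addrC addrK.
have down : \sum_(k < M) cis (p%:~R * (k%:R * s)) *: H (k%:R * s - s) =
    cis (p%:~R * s) *: \sum_(k < M) F (k%:R * s).
  have -> : \sum_(k < M) F (k%:R * s) = \sum_(k < M) F (k%:R * s - s).
    rewrite -(@sum_shift _ (fun t => F (t - s)));
      last by rewrite addrC F2 add0r.
    by apply: eq_bigr => k _; rewrite addrK.
  rewrite scaler_sumr; apply: eq_bigr => k _; rewrite /F scalerA -cisD.
  by congr (cis _ *: _); rewrite mulrBr addrC subrK.
have -> : (cis (p%:~R * s) + cis (- (p%:~R * s)) - 2) *: green p =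
  (M%:R^-1 : C) *: \sum_(k < M) cis (p%:~R * (k%:R * s)) *:
    (H (k%:R * s + s) + H (k%:R * s - s) - 2 *: H (k%:R * s)).
  rewrite /green scalerA mulrC -scalerA; congr (_ *: _).
  rewrite -[\sum_(k < M) _ in LHS]/(\sum_(k < M) F (k%:R * s)).
  rewrite [cis _ + cis _]addrC scalerBl scalerDl -up -down scaler_sumr.
  rewrite -big_split -sumrB; apply: eq_bigr => k _.
  by rewrite [in RHS]scalerBr [in RHS]scalerDr /F !scalerA [2 * _]mulrC.
apply: (@avg_le (fun k => cis (p%:~R * (k%:R * s)) *:
  (H (k%:R * s + s) + H (k%:R * s - s) - 2 *: H (k%:R * s)))) => k kM.
rewrite mnormZ cabs_cis mul1r.
have k0 : 0 <= k%:R * s by rewrite mulr_ge0 // (ltW s_gt0).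
have := ks_le kM; have := s_le; have := s_gt0 => s0 sp kp.
apply: HK; rewrite ler_norml; apply/andP; split; lra.
Qed.

End PeriodicGreen.

(** * Uniform summability of the Green function and orthogonality of characters *)

Section GreenSum.
Context {R : realType} {d : nat}.
Local Notation C := (Cplx R).
Variables (H : R -> 'M[C]_d) (M : nat) (s : R).
Hypothesis M_gt0 : (0 < M)%N.
Hypothesis Ms : M%:R * s = pi *+ 2.

Let g (p : int) := mnorm (green H M s p).

Let s_gt0 : 0 < s.
Proof. by rewrite -(@pmulr_rgt0 _ M%:R) ?ltr0n // Ms mulrn_wgt0 ?pi_gt0. Qed.

Let g_period p : g (p + M%:Z) = g p.
Proof. by rewrite /g green_period. Qed.

(** By periodicity the window sum does not depend on n; at n = M - 1 it is the right side in reverse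
    order. *)
Lemma sum_window n : \sum_(l < M) g (n - l%:Z) = \sum_(0 <= m < M) g m%:Z.
Proof.
pose h n := \sum_(l < M) g (n - l%:Z).
have hS m : h (m + 1) = h m.
  apply/eqP; rewrite -subr_eq0 /h -sumrB.
  have -> : \sum_(l < M) (g (m + 1 - l%:Z) - g (m - l%:Z)) =
      - \sum_(0 <= l < M) (g (m + 1 - l.+1%:Z) - g (m + 1 - l%:Z)).
    rewrite big_mkord -sumrN; apply: eq_bigr => l _; rewrite opprB.
    by congr (_ - g _); rewrite -addn1 PoszD; ring.
  rewrite (telescope_sumr (fun l : nat => g (m + 1 - l%:Z))) // subr0.
  by rewrite -[m + 1 in X in _ - X](subrK M%:Z) g_period subrr oppr0.
have h0 m : h m = h 0.
  elim/int_rec: m => [//|m IH|m IH]; first by rewrite -addn1 PoszD hS.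
  by rewrite -hS -addn1 PoszD opprD subrK.
rewrite -/(h n) h0 -(h0 (M%:Z - 1)) /h big_mkord [RHS](reindex_inj rev_ord_inj).
apply: eq_bigr => l _ /=; congr g; rewrite -subzn // -addn1 PoszD; ring.
Qed.

(** The factor s^2 cancels against [root_gap], which leaves a decay rate whose constant does not
    involve M. *)
Lemma green_decay K m : 0 <= K -> (0 < m < M)%N ->
  4 * sin (m%:R * s / 2) ^+ 2 * g m%:Z <= K * s ^+ 2 ->
  g m%:Z <= K * 4 * (m%:R ^- 2 + (M - m)%N%:R ^- 2).
Proof.
move=> K0 mM gK; have gap := root_gap mM Ms.
set q := _ + _ in gap *; set sg := 4 * _ ^+ 2 in gap gK.
have s2 : 0 < s ^+ 2 by rewrite exprn_gt0.
have q0 : 0 <= q by rewrite addr_ge0 ?invr_ge0 ?exprn_ge0.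
have sg0 : 0 < sg.
  rewrite lt_neqAle eq_sym /sg mulr_ge0 ?sqr_ge0 // andbT.
  by apply/eqP => sg0; move: gap; rewrite /sg sg0 mulr0 mul0r leNgt s2.
rewrite -(ler_pM2l sg0); apply: le_trans gK _.
rewrite (_ : sg * _ = K * (4 * sg * q)) ?ler_wpM2l //; ring.
Qed.

(** The term m = 0 is bounded by K1. The others decay, and after reversing one of the two
    inverse-square sums each is at most 2, whence 16 = 4 (2 + 2). *)
Lemma green_sum_le K1 K2 : 0 <= K2 -> (forall p, g p <= K1) ->
  (forall p : int, 4 * sin (p%:~R * s / 2) ^+ 2 * g p <= K2 * s ^+ 2) ->
  forall n, \sum_(l < M) g (n - l%:Z) <= K1 + K2 * 16.
Proof.
move=> K20 gK1 gK2 n; rewrite sum_window (big_ltn M_gt0).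
apply: lerD => //.
apply: (@le_trans _ _ (\sum_(1 <= m < M)
    K2 * 4 * (m%:R ^- 2 + (M - m)%N%:R ^- 2))).
  by apply: ler_sum_nat => m mM; apply: green_decay (gK2 m).
rewrite -mulr_sumr big_split /= [X in _ + X]big_nat_rev /= add1n.
rewrite [X in _ + X](eq_big_nat _ _ (F2 := fun m => m%:R ^- 2)); last first.
  by move=> m /andP[_ mM]; rewrite subSS subKn // ltnW.
have := @sum_inv_sqr_le R M; set q := \sum_(_ <= _ < _) _ => q2.
rewrite -mulrA ler_wpM2l //; lra.
Qed.

Lemma cis_root_neq1 m : (0 < m < M)%N -> cis (m%:R * s) != 1 :> C.
Proof.
move=> mM; apply/eqP => c1; have := cabs_cis_diff2 (m%:R * s).
rewrite cisN c1 invr1 subrr cabs0 => sin0.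
have := root_gap mM Ms; rewrite -sin0 mulr0 mul0r leNgt exprn_gt0 //.
Qed.

(** For n <> l the sum is geometric, and its ratio is an M-th root of unity other than 1. *)
Lemma sum_cis_root (n l : nat) : (n < M)%N -> (l < M)%N ->
  \sum_(k < M) cis ((n%:Z - l%:Z)%:~R * (k%:R * s)) = (M * (n == l))%:R :> C.
Proof.
move=> nM lM; have [->|nl] := eqVneq n l.
  rewrite muln1 subrr -[in RHS](card_ord M) -sumr_const.
  by apply: eq_bigr => k _; rewrite mul0r cis0.
have -> : \sum_(k < M) cis ((n%:Z - l%:Z)%:~R * (k%:R * s)) =
    \sum_(k < M) cis ((n%:Z - l%:Z)%:~R * s) ^+ k.
  by apply: eq_bigr => k _; rewrite mulrCA cisX.
set p := (_ - _)%:~R.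
have neq1 : cis (p * s) != 1.
  have pE : p = n%:R - l%:R by rewrite /p intrB.
  move: nl; rewrite neq_ltn => /orP[] h.
    have -> : p * s = - ((l - n)%N%:R * s) by rewrite natrB ?(ltnW h) // pE;
      ring.
    rewrite cisN invr_eq1 cis_root_neq1 // subn_gt0 h.
    exact: leq_ltn_trans (leq_subr _ _) lM.
  have -> : p * s = (n - l)%N%:R * s by rewrite natrB ?(ltnW h) // pE.
  by rewrite cis_root_neq1 // subn_gt0 h (leq_ltn_trans (leq_subr _ _) nM).
have := subrX1 (cis (p * s)) M; rewrite -cisX mulrCA Ms cis_periodic subrr.
by move=> /esym/eqP; rewrite mulf_eq0 subr_eq0 (negPf neq1) muln0 => /eqP.
Qed.

End GreenSum.

(** * Bounded solutions of the forced equation *)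

Section BoundedSolution.
Context {R : realType} {d : nat}.
Local Notation C := (Cplx R).
Variable A : nat -> 'M[C]_d.
Local Open Scope classical_set_scope.

Hypothesis cvgA :
  cvgn (series (fun j => (1 + j%:R) ^+ 2 * mnorm (A j) : R)).
Hypothesis symbol_unit : forall t, symbol A t \in unitmx.

Let H t := invmx (symbol A t).

Let H_periodic t : H (t + pi *+ 2) = H t.
Proof. by rewrite /H /symbol cisD cis_2pi mulr1. Qed.

(** On the mode e^{ipt} the kernel acts as e^{it} E - Delta(e^{it}); applied to H(t) this gives
    e^{it} H(t) - E. Averaging over the grid yields the equation forced by an impulse, written as a
    character sum. *)
Lemma green_msum M s (p : int) : msum_to
  (fun j => A j *m green H M s (p - j%:Z))
  (green H M s (p + 1) -
   (M%:R^-1 * \sum_(k < M) cis (p%:~R * (k%:R * s)))%:M).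
Proof.
have one t : msum_to (fun j => A j *m (cis ((p - j%:Z)%:~R * t) *: H t))
    (cis ((p + 1)%:~R * t) *: H t - (cis (p%:~R * t))%:M).
  have := msum_toZ (cis (p%:~R * t)) (msum_toMr (H t) (symbol_msum cvgA t)).
  move=> /msum_to_ext; apply=> [j|].
    rewrite -scalemxAl scalerA -cisD -scalemxAr; congr (cis _ *: _).
    by rewrite intrB mulrBl.
  rewrite mulmxBl mul_scalar_mx mulmxV // scalerBr scalerA -cisD scalemx1.
  by rewrite (_ : p%:~R * t + t = (p + 1)%:~R * t) // intrD mulrDl mul1r.
have := msum_toZ (M%:R^-1) (msum_to_sum (index_enum 'I_M) (fun k =>
  one (k%:R * s))).
move=> /msum_to_ext; apply => [j|].
  by rewrite /green -scalemxAr mulmx_sumr.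
rewrite sumrB scalerBr; congr (_ - _).
by rewrite -scalemx1 -scalerA; congr (_ *: _); rewrite scaler_suml;
  apply: eq_bigr => k _; rewrite scalemx1.
Qed.

(** The constant must be independent of M for the later limit. The equation is claimed for n < M
    only, where the periodic forcing agrees with f. *)
Lemma periodic_solution : exists2 K, 0 <= K &
  forall (M : nat) (f : nat -> 'cV[C]_d) b,
  (0 < M)%N -> (forall n, mnorm (f n) <= b) ->
  exists2 z : int -> 'cV[C]_d, (forall n, mnorm (z n) <= K * b) &
    forall n : nat, (n < M)%N ->
      msum_to (fun j => A j *m z (n%:Z - j%:Z)) (z (n%:Z + 1) - f n).
Proof.
(* The radius 4 pi contains the grid points of [0, 2 pi] and their neighbours at distance s <= 2
   pi. *)
have [K1 K10 HK1] := invmx_symbol_bounded cvgA symbol_unit (pi *+ 4).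
have [K2 K20 HK2] := invmx_symbol_diff2 cvgA symbol_unit (pi *+ 4).
exists (K1 + K2 * 16) => [|M f b M0 fb]; first by rewrite addr_ge0 ?mulr_ge0.
pose s : R := pi *+ 2 / M%:R.
have Ms : M%:R * s = pi *+ 2 by rewrite mulrC divfK // pnatr_eq0 -lt0n.
have b0 : 0 <= b by exact: le_trans (mnorm_ge0 _) (fb 0%N).
pose G := green H M s.
exists (fun n => \sum_(l < M) G (n - l%:Z) *m f l) => [n|n nM].
  apply: le_trans (mnorm_sum _ _ _) _.
  apply: (@le_trans _ _ (\sum_(l < M) mnorm (G (n - l%:Z)) * b)).
    apply: ler_sum => l _; apply: le_trans (mnormM _ _) _.
    by rewrite ler_wpM2l ?mnorm_ge0.
  rewrite -mulr_suml ler_wpM2r //.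
  apply: green_sum_le => //; first exact: green_le.
  exact: green_diff2.
have one (l : 'I_M) :
    msum_to (fun j => A j *m (G (n%:Z - j%:Z - l%:Z) *m f l))
      (G (n%:Z + 1 - l%:Z) *m f l - (if n == l then f l else 0)).
  apply: msum_to_ext (msum_toMr (f l) (green_msum M s (n%:Z - l%:Z))) _ _ =>
    [j|].
    by rewrite -mulmxA addrAC.
  (* The normalised character sum is 1 if n = l and 0 otherwise. *)
  rewrite mulmxBl addrAC (sum_cis_root M0 Ms nM (ltn_ord l)).
  case: eqP => _; first by rewrite muln1 mulVf ?mul1mx // pnatr_eq0 -lt0n.
  by rewrite muln0 mulr0 raddf0 mul0mx.
apply: msum_to_ext (msum_to_sum (index_enum 'I_M) one) _ _ => [j|].
  by rewrite mulmx_sumr.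
by rewrite sumrB -big_mkcond [X in _ - X](big_pred1 (Ordinal nM)).
Qed.

(** The ultralimit is taken at each argument separately; the infinite sum passes to the limit
    because its tails are uniformly small in M. *)
Lemma bounded_solution : exists2 K, 0 <= K & forall (f : nat -> 'cV[C]_d) b,
  (forall n, mnorm (f n) <= b) ->
  exists2 z : int -> 'cV[C]_d, (forall n, mnorm (z n) <= K * b) &
    forall n : nat,
      msum_to (fun j => A j *m z (n%:Z - j%:Z)) (z (n%:Z + 1) - f n).
Proof.
have [K K0 sol] := periodic_solution; exists K => // f b fb.
have /choice[zM zMP] (M : nat) : exists z : int -> 'cV[C]_d,
    (forall n, mnorm (z n) <= K * b) /\ forall n : nat, (n < M.+1)%N ->
      msum_to (fun j => A j *m z (n%:Z - j%:Z)) (z (n%:Z + 1) - f n).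
  by have [z z1 z2] := sol M.+1 f b isT fb; exists z.
have [U [UU ooU]] := nat_ultrafilter.
have UF : Filter U by exact: filter_filter.
have /choice[z zP] (n : int) := @ultralimit_mx R U UU _ _ (zM ^~ n) (K * b)
  (fun M => (zMP M).1 n).
have Kb0 : 0 <= K * b by exact: le_trans (mnorm_ge0 _) ((zMP 0%N).1 0).
exists z => [n|n].
  rewrite -[z n]subr0; apply: (ultralimit_le (zP n)).
  by apply: nearW => M; rewrite subr0; exact: (zMP M).1.
(* One dominating sequence for the terms of all the approximate solutions. *)
pose B j := K * b * mnorm (A j).
have cvgB : cvgn (series B).
  apply: (@series_le_cvg _ _ (fun j =>
    K * b * ((1 + j%:R) ^+ 2 * mnorm (A j)))).
  - by move=> j; rewrite mulr_ge0 ?mnorm_ge0.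
  - by move=> j; apply: mulr_ge0 => //; apply: mulr_ge0;
      [exact: sqr_ge0|exact: mnorm_ge0].
  - move=> j; apply: ler_wpM2l => //; rewrite -[leLHS]mul1r.
    by apply: ler_wpM2r; [exact: mnorm_ge0|rewrite exprn_ege1 // lerDl].
  - exact: is_cvg_seriesZ.
apply: (@tail_msum_to _ _ _ _ B _ 1 cvgB) => J; rewrite mul1r.
(* The residual after J terms: for [zM M] with M >= n it is a tail dominated by that of [B], and the
   bound is carried over to [z]. *)
pose S (y : int -> 'cV[C]_d) := y (n%:Z + 1) - f n -
  series (fun j => A j *m y (n%:Z - j%:Z)) J.
rewrite -/(S z) -[S z]subr0.
apply: (@ultralimit_le _ U UU _ _ (fun M => S (zM M))); last first.
  apply: ooU; exists n => // M /= nM; rewrite subr0 /S.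
  have uB j : mnorm (A j *m zM M (n%:Z - j%:Z)) <= B j.
    apply: le_trans (mnormM _ _) _; rewrite mulrC ler_wpM2r ?mnorm_ge0 //.
    exact: (zMP M).1.
  have [T Tu] := dominated_msum uB cvgB.
  suff -> : zM M (n%:Z + 1) - f n = T by exact: Tu.
  apply: msum_to_uniq ((zMP M).2 n nM) _.
  by apply: (@tail_msum_to _ _ _ _ B _ 1 cvgB) => k; rewrite mul1r.
(* The residual involves finitely many values of its argument, and [c] is a Lipschitz constant for
   it in those values. *)
move=> e e0; pose c := 1 + \sum_(0 <= j < J) mnorm (A j).
have c0 : 0 < c by rewrite ltr_pwDl // sumr_ge0 // => j _; exact: mnorm_ge0.
have e'0 : 0 < e / c by exact: divr_gt0.
have := @filter_forall _ _ (fun (j : 'I_J) M =>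
  mnorm (zM M (n%:Z - j%:Z) - z (n%:Z - j%:Z)) <= e / c) U UF
  (fun j => zP (n%:Z - j%:Z) _ e'0).
have := zP (n%:Z + 1) _ e'0.
apply: filterS2 => M zM1 zMJ.
have -> : S (zM M) - S z = (zM M (n%:Z + 1) - z (n%:Z + 1)) -
    \sum_(0 <= j < J) A j *m (zM M (n%:Z - j%:Z) - z (n%:Z - j%:Z)).
  have -> : \sum_(0 <= j < J) A j *m (zM M (n%:Z - j%:Z) - z (n%:Z - j%:Z)) =
      series (fun j => A j *m zM M (n%:Z - j%:Z)) J -
      series (fun j => A j *m z (n%:Z - j%:Z)) J.
    by rewrite /series /= -sumrB; apply: eq_bigr => j _; rewrite mulmxBr.
  rewrite /S; move: (series _ _) (series _ _) => P Q.
  by apply/matrixP => i k; rewrite !mxE; ring.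
have -> : e = e / c + (\sum_(0 <= j < J) mnorm (A j)) * (e / c).
  by rewrite -[X in X + _]mul1r -mulrDl mulrC divfK // gt_eqF.
apply: le_trans (mnormB _ _) (lerD zM1 _).
apply: le_trans (mnorm_sum _ _ _) _; rewrite mulr_suml.
apply: ler_sum_nat => j /andP[_ jJ]; apply: le_trans (mnormM _ _) _.
by rewrite ler_wpM2l ?mnorm_ge0 //; exact: (zMJ (Ordinal jJ)).
Qed.

End BoundedSolution.

(** * Equivalence of norms and summability of the kernel *)

Section NormEquivalence.
Context {R : realType} {d : nat}.
Local Notation C := (Cplx R).
Variable N : 'cV[C]_d -> R.
Hypothesis hN : is_norm N.
Local Open Scope classical_set_scope.

Lemma is_norm_cabs (a : C) u : N (a *: u) = cabs a * N u.
Proof. by apply: complexI; rewrite (is_normZ hN) rmorphM. Qed.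

Lemma is_norm0 : N 0 = 0.
Proof. by rewrite -[in N 0](scale0r 0) is_norm_cabs cabs0 mul0r. Qed.

Lemma is_normN u : N (- u) = N u.
Proof. by rewrite -scaleN1r is_norm_cabs cabsN cabs1 mul1r. Qed.

Lemma is_norm_sum (I : Type) (r : seq I) (F : I -> 'cV[C]_d) :
  N (\sum_(i <- r) F i) <= \sum_(i <- r) N (F i).
Proof.
elim/big_rec2: _ => [|i y x _ le_xy]; first by rewrite is_norm0.
exact: le_trans (is_normD hN _ _) (lerD _ _).
Qed.

Lemma norm_le_mnorm_ex : exists2 c, 0 <= c & forall u, N u <= c * mnorm u.
Proof.
exists (\sum_(i < d) N (delta_mx i 0)) => [|u].
  by apply: sumr_ge0 => i _; exact: is_norm_ge0 hN _.
rewrite {1}(matrix_sum_delta u); apply: le_trans (is_norm_sum _ _) _.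
rewrite mulr_suml; apply: ler_sum => i _; rewrite big_ord1 is_norm_cabs mulrC.
by rewrite ler_wpM2l ?cabs_le_mnorm // (is_norm_ge0 hN).
Qed.

(** Compactness: otherwise vectors with [mnorm] 1 and k N(u_k) <= 1 have an ultralimit v with N(v) =
    0, so v = 0, although the u_k approach v in [mnorm]. *)
Lemma mnorm_le_norm_ex : exists2 c, 0 <= c & forall u, mnorm u <= c * N u.
Proof.
have [c c0 Nc] := norm_le_mnorm_ex.
apply: contrapT => unb.
have /choice[u uP] (k : nat) : exists u, mnorm u = 1 /\ k%:R * N u <= 1.
  apply: contrapT => nex; apply: unb; exists k%:R => // u.
  have [-> |u0] := eqVneq (mnorm u) 0;
    first by rewrite mulr_ge0 ?(is_norm_ge0 hN).
  have u_gt0 : 0 < mnorm u by rewrite lt0r u0 mnorm_ge0.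
  rewrite leNgt; apply/negP => ku; apply: nex.
  exists (((mnorm u)^-1)%:C%C *: u).
  have aE : cabs (((mnorm u)^-1)%:C%C : C) = (mnorm u)^-1.
    by rewrite cabs_real ger0_norm // invr_ge0 ltW.
  rewrite mnormZ is_norm_cabs aE mulVf //; split=> //.
  by rewrite mulrCA ler_pdivrMl // mulr1 ltW.
have [U [UU ooU]] := nat_ultrafilter.
have [|v uv] := @ultralimit_mx R U UU _ _ u 1; first by move=> k;
  rewrite (uP k).1.
have v0 : v = 0.
  apply: (is_norm_eq0 hN); apply/eqP; rewrite eq_le (is_norm_ge0 hN) andbT.
  apply/ler_addgt0Pr => e e0; rewrite add0r.
  have c1 : 0 < c + 1 by rewrite ltr_wpDl.
  have far : \forall k \near U, e^-1 * 2 <= k%:R.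
    exact: ooU (nbhs_infty_ger _).
  have := uv (e / 2 / (c + 1)) (divr_gt0 (divr_gt0 e0 (ltr0n _ 2)) c1).
  move=> /(filterI far) /filter_ex [k [/= ke ukv]].
  rewrite -[v](subKr (u k)) [e]splitr.
  apply: le_trans (is_normD hN _ _) (lerD _ _).
    have := (uP k).2; have := is_norm_ge0 hN (u k) => N0 kN.
    have : e^-1 * 2 * N (u k) <= 1 by apply: le_trans kN; rewrite ler_wpM2r.
    by rewrite -mulrA ler_pdivrMl // mulr1 mulrC -ler_pdivlMr.
  rewrite is_normN; apply: le_trans (Nc _) _.
  apply: (@le_trans _ _ (c * (e / 2 / (c + 1)))); first exact: ler_wpM2l.
  rewrite mulrCA ler_piMr ?divr_ge0 ?(ltW e0) // ler_pdivrMr // mul1r lerDl //.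
have [|k /=] := filter_ex (uv 2^-1 _); first by rewrite invr_gt0.
by rewrite v0 subr0 (uP k).1; lra.
Qed.

Lemma mnorm_le_op_norm : exists2 c, 0 <= c & forall (M : 'M[C]_d) r,
  (op_norm N M <= r%:E)%E -> mnorm M <= c * r.
Proof.
have [c c0 Nc] := mnorm_le_norm_ex.
pose D (j : 'I_d) : 'cV[C]_d := delta_mx j 0.
have D0 j : 0 <= N (D j) by exact: is_norm_ge0.
(* Dividing a basis vector by 1 + N puts it into the unit ball of N, so each column of M is
   controlled by the operator norm. *)
exists (\sum_j c * (1 + N (D j))) => [|M r Mr].
  by apply: sumr_ge0 => j _; rewrite mulr_ge0 ?addr_ge0.
have small u : N u <= 1 -> N (M *m u) <= r.
  by move=> u1; rewrite -lee_fin; apply: le_trans Mr; apply: ereal_sup_ubound;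
    exists u.
have MD j : N (M *m D j) <= (1 + N (D j)) * r.
  have a0 : 0 < 1 + N (D j) by rewrite ltr_wpDr.
  have aE : cabs (((1 + N (D j))^-1)%:C%C : C) = (1 + N (D j))^-1.
    by rewrite cabs_real ger0_norm // invr_ge0 ltW.
  have := small (((1 + N (D j))^-1)%:C%C *: D j).
  rewrite -scalemxAr !is_norm_cabs aE !ler_pdivrMl // mulr1; apply.
  by rewrite lerDr.
have -> : mnorm M = \sum_j mnorm (M *m D j).
  rewrite /mnorm exchange_big; apply: eq_bigr => j _; apply: eq_bigr => i _.
  by rewrite big_ord1 -colE mxE.
rewrite mulr_suml; apply: ler_sum => j _; apply: le_trans (Nc _) _.
by rewrite -mulrA ler_wpM2l.
Qed.

(** * Exponential and quadratic summability of the kernel *)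

Section Kernel.
Variables (gamma : R) (A : nat -> 'M[C]_d).
Hypothesis gamma_gt0 : 0 < gamma.
Hypothesis hA : (\sum_(0 <= j <oo) (op_norm N (A j) * (expR (gamma * j%:R))%:E)
                   < +oo)%E.

Lemma cvg_weighted_kernel :
  cvgn (series (fun j => mnorm (A j) * expR (gamma * j%:R))).
Proof.
have [c c0 Ac] := mnorm_le_op_norm.
have op0 j : (0 <= op_norm N (A j))%E.
  apply: ereal_sup_ubound; exists 0; rewrite /= ?is_norm0 //.
  by rewrite mulmx0 is_norm0.
have t0 j : (0 <= op_norm N (A j) * (expR (gamma * j%:R))%:E)%E.
  by rewrite mule_ge0 // lee_fin expR_ge0.
have part n := @nneseries_lim_ge R _ xpredT 0 n (fun j _ _ => t0 j).
have := hA; set T := (X in (X < _)%E) in part * => Tlt.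
have Tfin : T \is a fin_num.
  by rewrite ge0_fin_numE //; apply: le_trans (part 0%N); rewrite big_geq.
(* An infinite operator norm would make a partial sum, hence the total, infinite. *)
have opfin j : op_norm N (A j) \is a fin_num.
  rewrite ge0_fin_numE // ltNge leye_eq; apply/negP => /eqP Ainf.
  have := part j.+1; rewrite big_nat_recr //= Ainf gt0_mulye ?lte_fin ?expR_gt0
    //.
  rewrite addey; last by rewrite gt_eqF // (lt_le_trans ltNy0) // sume_ge0.
  by rewrite leye_eq => /eqP TE; move: Tlt; rewrite /T TE ltxx.
apply: nondecreasing_is_cvgn.
  apply: nondecreasing_series => j _ _.
  by rewrite mulr_ge0 ?mnorm_ge0 ?expR_ge0.
exists (c * fine T) => _ [n _ <-].
apply: (@le_trans _ _ (c * \sum_(0 <= j < n)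
    (fine (op_norm N (A j)) * expR (gamma * j%:R)))).
  rewrite mulr_sumr; apply: ler_sum => j _;
    rewrite mulrA ler_wpM2r ?expR_ge0 //.
  by apply: Ac; rewrite fineK.
rewrite ler_wpM2l // -lee_fin fineK // -sumEFin; apply: le_trans (part n).
by apply: lee_sum => j _; rewrite EFinM fineK.
Qed.

Lemma sqr_le_expR : exists2 c, 0 <= c &
  forall j : nat, (1 + j%:R) ^+ 2 <= c * expR (gamma * j%:R).
Proof.
(* Square of 1 + j <= (1 + 2/gamma) (1 + gamma j / 2), combined with 1 + x <= e^x at x = gamma j /
   2. *)
exists ((1 + 2 / gamma) ^+ 2) => [|j]; first exact: sqr_ge0.
have -> : expR (gamma * j%:R) = expR (gamma * j%:R / 2) ^+ 2.
  by rewrite -expRM_natl [2 * _]mulrC divfK.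
have a0 : 0 <= 2 / gamma by rewrite divr_ge0 // ltW.
have b0 : 0 <= gamma * j%:R / 2 by rewrite !mulr_ge0 // ltW.
rewrite -exprMn; apply: lerXn2r; rewrite ?nnegrE; first exact: addr_ge0.
  by rewrite mulr_ge0 ?expR_ge0 // addr_ge0.
apply: (@le_trans _ _ ((1 + 2 / gamma) * (1 + gamma * j%:R / 2))); last first.
  by rewrite ler_wpM2l ?addr_ge0 // expR_ge1Dx.
have -> : (1 + 2 / gamma) * (1 + gamma * j%:R / 2) =
    1 + j%:R + (2 / gamma + gamma * j%:R / 2).
  by field; rewrite gt_eqF.
by rewrite lerDl addr_ge0.
Qed.

Lemma cvg_quadratic_kernel :
  cvgn (series (fun j => (1 + j%:R) ^+ 2 * mnorm (A j))).
Proof.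
have [c c0 ec] := sqr_le_expR.
apply: (@series_le_cvg _ _ (fun j => c * (mnorm (A j) * expR (gamma * j%:R)))).
- by move=> j; apply: mulr_ge0; [exact: sqr_ge0|exact: mnorm_ge0].
- by move=> j; rewrite !mulr_ge0 ?mnorm_ge0 ?expR_ge0.
- by move=> j; rewrite mulrCA mulrC ler_wpM2l ?mnorm_ge0.
- by apply: is_cvg_seriesZ; exact: cvg_weighted_kernel.
Qed.

End Kernel.
End NormEquivalence.

(** * Shadowing in the absence of unimodular roots *)

Section PhaseSpace.
Context {R : realType} {d : nat}.
Local Notation C := (Cplx R).
Variables (N : 'cV[C]_d -> R) (gamma : R).
Hypothesis hN : is_norm N.
Hypothesis gamma_gt0 : 0 < gamma.
Local Open Scope classical_set_scope.

Lemma phase_norm_leP phi c : (phase_norm N gamma phi <= c%:E)%E <->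
  forall theta : Zle0, N (phi theta) * expR (gamma * (val theta)%:~R) <= c.
Proof.
split=> [phic theta|phic].
  by rewrite -lee_fin; apply: le_trans phic; apply: ereal_sup_ubound;
    exists theta.
by apply: ge_ereal_sup => _ [theta _ <-]; rewrite lee_fin.
Qed.

Lemma phase_spaceP phi : phase_space N gamma phi <-> exists c,
  forall theta : Zle0, N (phi theta) * expR (gamma * (val theta)%:~R) <= c.
Proof.
split=> [phi_lt|[c /phase_norm_leP phic]];
  last exact: le_lt_trans phic (ltry _).
exists (fine (phase_norm N gamma phi)); apply/phase_norm_leP.
rewrite fineK // ge0_fin_numE //.
apply: le_trans (ereal_sup_ubound _); last by exists (negz_nat 0).
by rewrite lee_fin mulr_ge0 ?(is_norm_ge0 hN) ?expR_ge0.
Qed.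

Lemma expR_hist_le1 (theta : Zle0) : expR (gamma * (val theta)%:~R) <= 1.
Proof.
rewrite expR_le1 pmulr_rle0 // lerz0; exact: valP theta.
Qed.

(** Shifting only lowers the weight on the old history; the new values are finitely many, and the
    sum of their norms is added to the bound. *)
Lemma segment_phase_space (y : int -> 'cV[C]_d) n :
  phase_space N gamma (segment y 0) -> phase_space N gamma (segment y n).
Proof.
move=> /phase_spaceP[c yc]; apply/phase_spaceP.
exists (c + \sum_(k < n.+1) N (y k%:Z)) => theta; rewrite /segment.
have c0 : 0 <= c.
  by apply: le_trans (yc (negz_nat 0));
    rewrite mulr_ge0 ?(is_norm_ge0 hN) ?expR_ge0.
have S0 : 0 <= \sum_(k < n.+1) N (y k%:Z).
  by apply: sumr_ge0 => k _; exact: is_norm_ge0.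
have [le0|gt0] := lerP (n%:Z + val theta) 0.
  pose theta' : Zle0 := exist _ (n%:Z + val theta) le0.
  apply: ler_wpDr => //; apply: le_trans (yc theta').
  rewrite /segment add0r ler_wpM2l ?(is_norm_ge0 hN) //.
  rewrite ler_expR ler_wpM2l ?(ltW gamma_gt0) //.
  by rewrite ler_int /= lerDr.
apply: ler_wpDl => //.
case E : (n%:Z + val theta) gt0 => [k|//] _.
have kn : (k < n.+1)%N.
  by rewrite ltnS -lez_nat -E gerDl; exact: valP theta.
apply: (@le_trans _ _ (N (y k%:Z))).
  by rewrite ler_piMr ?(is_norm_ge0 hN) ?expR_hist_le1.
rewrite (bigD1 (Ordinal kn)) //= lerDl.
by apply: sumr_ge0 => l _; exact: is_norm_ge0.
Qed.

Variable A : nat -> 'M[C]_d.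
Hypothesis cvgA : cvgn (series (fun j => mnorm (A j) * expR (gamma * j%:R))).

Lemma kernel_msum_ex (u : nat -> 'cV[C]_d) c :
  (forall j, N (u j) <= c * expR (gamma * j%:R)) ->
  exists S, msum_to (fun j => A j *m u j) S.
Proof.
have [b b0 Nb] := mnorm_le_norm_ex hN => uc.
apply: (@msum_to_ex _ _ _ _
  (fun j => b * c * (mnorm (A j) * expR (gamma * j%:R)))).
  move=> j; apply: le_trans (mnormM _ _) _;
    rewrite mulrCA ler_wpM2l ?mnorm_ge0 //.
  by apply: le_trans (Nb _) _; rewrite -mulrA ler_wpM2l.
exact: is_cvg_seriesZ.
Qed.

(** Guarantees that the [limn] in [volterra_op] is a genuine sum on the phase space and not a
    default value. *)
Lemma volterra_op_msum phi : phase_space N gamma phi ->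
  msum_to (fun j => A j *m phi (negz_nat j)) (volterra_op A phi).
Proof.
move=> /phase_spaceP[c phic].
have [|S uS] := @kernel_msum_ex (fun j => phi (negz_nat j)) c.
  move=> j; rewrite -ler_pdivrMr ?expR_gt0 // -expRN -mulrN.
  by have := phic (negz_nat j); rewrite /= mulrNz.
by rewrite /volterra_op (msum_to_limn uS).
Qed.

Hypothesis cvg2A : cvgn (series (fun j => (1 + j%:R) ^+ 2 * mnorm (A j) : R)).

Lemma no_root_shadowable :
  ~ (exists lambda : C, char_root gamma A lambda /\ `|lambda| = 1) ->
  shadowable N gamma A.
Proof.
move=> noroot.
have symbol_unit t : symbol A t \in unitmx.
  rewrite unitmxE unitfE; apply/eqP => det0; apply: noroot; exists (cis t).
  have n1 : `|cis t| = 1 by rewrite normr_cabs cabs_cis.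
  split=> //; split=> //; rewrite n1 -[1]/((1 : R)%:C%C) ltcR expR_lt1.
  by rewrite oppr_lt0.
have [K K0 sol] := bounded_solution cvg2A symbol_unit.
have [c1 c10 Nc1] := norm_le_mnorm_ex hN.
have [c2 c20 Nc2] := mnorm_le_norm_ex hN.
(* The error passes from N to [mnorm] (c2), through the solution operator (K) and back (c1); the
   added 1 keeps [k] positive. *)
move=> eps eps0; pose k := c1 * (K * c2) + 1.
have k0 : 0 < k by rewrite ltr_wpDl ?mulr_ge0.
exists (eps / k) => [|y yB yerr]; first exact: divr_gt0.
pose f n := y (n%:Z + 1) - volterra_op A (segment y n).
have Nf n : N (f n) <= eps / k.
  by rewrite -lee_fin; apply: le_trans yerr; apply: ereal_sup_ubound; exists n.
have [|z zK zsol] := sol f (c2 * (eps / k)).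
  by move=> n; apply: le_trans (Nc2 _) _; rewrite ler_wpM2l.
have Nz n : N (z n) <= eps.
  apply: le_trans (Nc1 _) _.
  apply: (@le_trans _ _ (c1 * (K * (c2 * (eps / k))))); first exact: ler_wpM2l.
  rewrite (_ : c1 * _ = c1 * (K * c2) / k * eps); last by ring.
  by rewrite ler_piMl ?(ltW eps0) // ler_pdivrMr // mul1r lerDl.
have Nzw (theta : Zle0) n : N (z n) * expR (gamma * (val theta)%:~R) <= eps.
  apply: le_trans (Nz n).
  by rewrite ler_piMr ?(is_norm_ge0 hN) ?expR_hist_le1.
(* The correction also alters the history, which is harmless: [z] is bounded on all of Z and the
   weight is at most 1. *)
pose x n := y n - z n; exists x; last first.
  apply: ge_ereal_sup => _ [n _ <-]; apply/phase_norm_leP => theta.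
  by rewrite /segment /x addrAC subrr add0r (is_normN hN).
exists (segment x 0).
  have /phase_spaceP[c yc] := yB; apply/phase_spaceP; exists (c + eps) => theta.
  apply: le_trans (lerD (yc theta) (Nzw theta (0%:Z + val theta))).
  rewrite -mulrDl ler_wpM2r ?expR_ge0 // /segment /x.
  by rewrite -(is_normN hN (z _)) (is_normD hN).
split=> [n|theta]; last by rewrite /segment add0r.
apply/esym/msum_to_limn.
apply: msum_to_ext (msum_toB (volterra_op_msum (segment_phase_space n yB))
  (zsol n)) _ _.
  by move=> j; rewrite -mulmxBr.
rewrite /f /x; move: (volterra_op _ _) (y _) (z _) => P Q S.
by apply/matrixP => i l; rewrite !mxE; ring.
Qed.

End PhaseSpace.

(** * Resonance at a unimodular root *)

Section ForcedSolution.
Context {R : realType} {d : nat}.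
Local Notation C := (Cplx R).
Variables (A : nat -> 'M[C]_d) (g : nat -> 'cV[C]_d).

(* [forced_table n] is correct at the arguments [m <= n] only. *)
Fixpoint forced_table (n : nat) : nat -> 'cV[C]_d :=
  if n is n'.+1 then fun m =>
    if (m <= n')%N then forced_table n' m
    else \sum_(0 <= j < n) A j *m forced_table n' (n' - j) + g n'
  else fun=> 0.

(** The diagonal of the table: the solution forced by [g] with zero history, the argument 0
    included. *)
Definition forced (m : int) : 'cV[C]_d :=
  if m is Posz n then forced_table n n else 0.

Lemma forced_tableE n m : (m <= n)%N -> forced_table n m = forced m%:Z.
Proof.
elim: n m => [|n IH] m; first by rewrite leqn0 => /eqP ->.
rewrite leq_eqVlt => /orP[/eqP -> //|]; rewrite ltnS => mn /=.
by rewrite mn IH.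
Qed.

Lemma forced_le0 (m : int) : m <= 0 -> forced m = 0.
Proof. by case: m => [[|n]|n]. Qed.

Lemma forcedS (n : nat) : forced (n%:Z + 1) =
  \sum_(0 <= j < n.+1) A j *m forced (n%:Z - j%:Z) + g n.
Proof.
rewrite -PoszD addn1 /= ltnn; congr (_ + _).
apply: eq_big_nat => j /andP[_ jn].
by rewrite forced_tableE ?leq_subr // subzn.
Qed.

Lemma forced_msum (n : nat) : msum_to
  (fun j => A j *m forced (n%:Z - j%:Z)) (forced (n%:Z + 1) - g n).
Proof.
have zero_tail k : (n < k)%N ->
    series (fun j => A j *m forced (n%:Z - j%:Z)) k = forced (n%:Z + 1) - g n.
  move=> nk; rewrite forcedS addrK /series /= (big_cat_nat _ nk) //=.
  rewrite [X in _ + X]big_nat_cond [X in _ + X]big1 ?addr0 // => j.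
  rewrite andbT => /andP[nj _]; rewrite forced_le0 ?mulmx0 //.
  by rewrite subr_le0 lez_nat ltnW.
apply: cvg_near_cst; exists n.+1 => // k /= nk.
by rewrite zero_tail // subrr mnorm0.
Qed.

End ForcedSolution.

Lemma sum_translate_step (V : zmodType) (y : int -> V) (M : nat) (p : int) :
  \sum_(n < M) y (n%:Z + (p + 1)) - \sum_(n < M) y (n%:Z + p) =
    y (M%:Z + p) - y p.
Proof.
elim: M => [|M IH]; first by rewrite !big_ord0 subrr add0r subrr.
rewrite !big_ord_recr opprD addrACA IH addrC addrA subrK /=.
by congr (y _ - _); rewrite -addn1 PoszD -addrA [1 + p]addrC.
Qed.

Section Resonance.
Context {R : realType} {d : nat}.
Local Notation C := (Cplx R).
Local Open Scope classical_set_scope.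
Variables (gamma : R) (A : nat -> 'M[C]_d) (lambda : C).
Hypothesis gamma_gt0 : 0 < gamma.
Hypothesis cvgA : cvgn (series (fun j => mnorm (A j) * expR (gamma * j%:R))).
Hypothesis cvg2A : cvgn (series (fun j => (1 + j%:R) ^+ 2 * mnorm (A j) : R)).
Hypothesis lambda1 : cabs lambda = 1.

Let lambda_neq0 : lambda != 0.
Proof. by apply/eqP => l0; move: lambda1; rewrite l0 cabs0; lra. Qed.

Let cabs_lambda (p : int) : cabs (lambda ^ p) = 1.
Proof.
case: p => n; first by rewrite -exprnP cabsX lambda1 expr1n.
by rewrite NegzE -exprnN cabsV cabsX lambda1 expr1n invr1.
Qed.

Variables (z : int -> 'cV[C]_d) (w : 'cV[C]_d) (q : 'rV[C]_d) (c : R).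
Hypothesis z_hist : forall n j : nat,
  mnorm (z (n%:Z - j%:Z)) <= c * expR (gamma * j%:R).
Hypothesis z_sol : forall n : nat, msum_to (fun j => A j *m z (n%:Z - j%:Z))
  (z (n%:Z + 1) + lambda ^ n *: w).
Hypothesis q_null : q *m char_mx A lambda = 0.

(** This rotation makes the resonant forcing constant, so that it accumulates to [M%:R *: w] over M
    steps, and it preserves moduli. *)
Let y (p : int) : 'cV[C]_d := lambda ^ (- p) *: z p.

Let c_ge0 : 0 <= c.
Proof.
have := z_hist 0 0; rewrite mulr0 expR0 mulr1; apply: le_trans.
exact: mnorm_ge0.
Qed.

Let y_hist (n j : nat) : mnorm (y (n%:Z - j%:Z)) <= c * expR (gamma * j%:R).
Proof. by rewrite mnormZ cabs_lambda mul1r. Qed.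

Let P (M : nat) (p : int) : 'cV[C]_d := \sum_(n < M) y (n%:Z + p).

Let P_step M p : P M (p + 1) - P M p = y (M%:Z + p) - y p.
Proof.
exact: sum_translate_step.
Qed.

(** The geometric sum of the e^{-gamma k}; its fixed-point identity kappa e^{-gamma} + 1 = kappa
    closes the induction on j in [P_drift]. *)
Let kappa : R := (1 - expR (- gamma))^-1.

Let kappa_den : 0 < 1 - expR (- gamma).
Proof. by rewrite subr_gt0 expR_lt1 oppr_lt0. Qed.

Let kappa_ge0 : 0 <= kappa.
Proof. by rewrite invr_ge0 ltW. Qed.

(* The window sums over [p, p + M) change slowly with p, since each step only
   replaces one end term by another and the history weights are geometric. *)
Let P_drift M j :
  mnorm (P M (- j%:Z) - P M 0) <= c * 2 * kappa * expR (gamma * j%:R).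
Proof.
have kappaE : kappa * expR (- gamma) + 1 = kappa.
  by rewrite /kappa; field; rewrite gt_eqF.
elim: j => [|j IH]; first by rewrite subrr mnorm0 !mulr_ge0 ?expR_ge0.
have eS : expR (gamma * j%:R) = expR (- gamma) * expR (gamma * j.+1%:R).
  by rewrite -expRD -natr1; congr expR; ring.
have -> : P M (- j.+1%:Z) - P M 0 = (P M (- j%:Z) - P M 0) -
    (y (M%:Z - j.+1%:Z) - y (0%:Z - j.+1%:Z)).
  rewrite sub0r -P_step (_ : - j.+1%:Z + 1 = - j%:Z); last first.
    by rewrite -addn1 PoszD opprD addrK.
  by rewrite opprB [RHS]addrC addrA subrK.
apply: le_trans (mnormB _ _) _.
apply: le_trans (lerD IH (mnormB _ _)) _.
apply: le_trans (lerD (lexx _) (lerD (y_hist M j.+1) (y_hist 0 j.+1))) _.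
rewrite eS -[X in _ <= _ * X * _]kappaE le_eqVlt; apply/orP; left; apply/eqP.
by ring.
Qed.

(** In the rotated equation summed over [0, M), replacing each window sum [P M (- j)] by [P M 0]
    costs O(1). What remains is Delta(lambda) [P M 0] + M w plus boundary terms, and q annihilates
    the first term. *)
Lemma resonance_bound : exists B,
  forall M : nat, cabs (M%:R * (q *m w) 0 0) <= B.
Proof.
pose D := char_mx A lambda.
pose T := limn (series (fun j => mnorm (A j) * expR (gamma * j%:R))).
exists (mnorm q * (c * 2 * kappa * T + c * 2)) => M.
have sum1 n : msum_to (fun j => lambda ^- j *: A j *m y (n%:Z - j%:Z))
    (lambda *: y (n%:Z + 1) + w).
  have := msum_toZ (lambda ^ (- n%:Z)) (z_sol n).
  move=> /msum_to_ext; apply => [j|].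
    rewrite /y -!scalemxAl -!scalemxAr scalerA exprnN -expfzDr //.
    by congr (_ ^ _ *: _); ring.
  rewrite scalerDr !scalerA -expfzDr // addNr expr0z scale1r;
    congr (_ *: _ + _).
  by rewrite -{2}[lambda]expr1z -expfzDr //; congr (_ ^ _); ring.
have sumM : msum_to (fun j => lambda ^- j *: A j *m P M (- j%:Z))
    (lambda *: P M 1 + M%:R *: w).
  have := msum_to_sum (index_enum 'I_M) (fun n : 'I_M => sum1 n).
  move=> /msum_to_ext; apply => [j|]; first by rewrite /P mulmx_sumr.
  by rewrite big_split /= -scaler_sumr sumr_const card_ord scaler_nat.
have := msum_toB sumM (msum_toMr (P M 0) (char_mx_msum cvg2A lambda1)).
set u := (X in msum_to X); set S := (X in msum_to _ X) => uS.
(* The drift grows like e^{gamma j}, exactly what the kernel sums against; the bound does not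
   involve M. *)
have S_le : mnorm S <= c * 2 * kappa * T.
  apply: msum_to_le uS _ => k.
  apply: (@le_trans _ _ (c * 2 * kappa *
      \sum_(0 <= j < k) mnorm (A j) * expR (gamma * j%:R))).
    rewrite mulr_sumr; apply: ler_sum => j _.
    rewrite /u -mulmxBr -scalemxAl mnormZ cabsV cabsX lambda1 expr1n invr1
      mul1r.
    apply: le_trans (mnormM _ _) _; rewrite mulrCA ler_wpM2l ?mnorm_ge0 //.
  rewrite ler_wpM2l ?mulr_ge0 //.
  apply: nondecreasing_cvgn_le (nondecreasing_series _) cvgA k => j _ _.
  by rewrite mulr_ge0 ?mnorm_ge0 ?expR_ge0.
have qS : q *m S = lambda *: (q *m (y M%:Z - y 0)) + M%:R *: (q *m w).
  have PM : P M 1 - P M 0 = y M%:Z - y 0.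
    by have := P_step M 0; rewrite add0r addr0.
  have -> : S = lambda *: (P M 1 - P M 0) + M%:R *: w + D *m P M 0.
    rewrite /S mulmxBl mul_scalar_mx -/D.
    move: (P M 1) (P M 0) (D *m _) => X Y Z.
    by apply/matrixP => i j; rewrite !mxE; ring.
  by rewrite mulmxDr mulmxA q_null mul0mx addr0 PM mulmxDr -!scalemxAr.
have -> : M%:R * (q *m w) 0 0 = (q *m (S - lambda *: (y M%:Z - y 0))) 0 0.
  by rewrite mulmxBr qS -scalemxAr [_ *: _ + _]addrC addrK [RHS]mxE.
apply: le_trans (cabs_le_mnorm _ _ _) _; apply: le_trans (mnormM _ _) _.
rewrite ler_wpM2l ?mnorm_ge0 //; apply: le_trans (mnormB _ _) (lerD S_le _).
rewrite mnormZ lambda1 mul1r mulr_natr mulr2n;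
  apply: le_trans (mnormB _ _) (lerD _ _).
  by have := y_hist M 0; rewrite subr0 mulr0 expR0 mulr1.
by have := y_hist 0 0; rewrite subr0 mulr0 expR0 mulr1.
Qed.

End Resonance.

(** * From shadowing to the absence of unimodular roots *)

Section ShadowableNoRoot.
Context {R : realType} {d : nat}.
Local Notation C := (Cplx R).
Local Open Scope classical_set_scope.
Variables (N : 'cV[C]_d -> R) (gamma : R) (A : nat -> 'M[C]_d).
Hypothesis hN : is_norm N.
Hypothesis gamma_gt0 : 0 < gamma.
Hypothesis cvgA : cvgn (series (fun j => mnorm (A j) * expR (gamma * j%:R))).
Hypothesis cvg2A : cvgn (series (fun j => (1 + j%:R) ^+ 2 * mnorm (A j) : R)).

Lemma shadowable_no_root : shadowable N gamma A ->
  ~ (exists lambda : C, char_root gamma A lambda /\ `|lambda| = 1).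
Proof.
move=> shadow [lambda [[_ det0] /cabs_eq lambda1]].
have [q q0 q_null] : exists2 q : 'rV_d, q != 0 & q *m char_mx A lambda = 0.
  by apply/det0P/eqP.
have [i qi] : exists i, q 0 i != 0.
  by apply/existsP; apply: contraNT q0; rewrite negb_exists => /forallP q0;
    apply/eqP/rowP => i; rewrite mxE; apply/eqP; move: (q0 i); rewrite negbK.
have [delta delta0 dshadow] := shadow 1 ltr01.
(* A direction with q e <> 0; scaling it by delta / (1 + N e) gives a forcing of norm at most
   delta. *)
pose e : 'cV[C]_d := delta_mx i 0.
have Ne0 : 0 < 1 + N e by rewrite ltr_wpDr ?(is_norm_ge0 hN).
pose a : R := delta / (1 + N e).
have a0 : 0 < a by exact: divr_gt0.
pose w : 'cV[C]_d := (a%:C%C : C) *: e.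
have Nw : N w <= delta.
  rewrite is_norm_cabs // cabs_real (gtr0_norm a0) /a mulrAC ler_pdivrMr //.
  by rewrite ler_wpM2l ?(ltW delta0) // lerDr.
pose g (n : nat) := lambda ^ n *: w; pose y := forced A g.
have y_hist (theta : Zle0) : segment y 0 theta = 0.
  by rewrite /segment add0r; apply: forced_le0; exact: valP theta.
have [||x [phi _ [x_sol _]] xy] := dshadow y.
- by apply/(phase_spaceP gamma hN); exists 0 => theta;
    rewrite y_hist is_norm0 // mul0r.
- apply: ge_ereal_sup => _ [n _ <-]; rewrite lee_fin.
  rewrite /volterra_op (msum_to_limn (forced_msum A g n)) subKr.
  by rewrite is_norm_cabs // cabsX lambda1 expr1n mul1r.
pose z (n : int) : 'cV[C]_d := x n - y n.
have Nz (n j : nat) : N (z (n%:Z - j%:Z)) <= 1 * expR (gamma * j%:R).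
  rewrite -ler_pdivrMr ?expR_gt0 // -expRN -mulrN.
  have xyn : (phase_norm N gamma (fun theta =>
      (segment x n theta - segment y n theta)%R) <= 1%:E)%E.
    by apply: le_trans xy; apply: ereal_sup_ubound; exists n.
  move/phase_norm_leP : xyn => /(_ (negz_nat j)).
  by rewrite /= mulrNz.
have [c c0 Nc] := mnorm_le_norm_ex hN.
have z_hist (n j : nat) : mnorm (z (n%:Z - j%:Z)) <= c * expR (gamma * j%:R).
  by apply: le_trans (Nc _) _; rewrite ler_wpM2l // -[leRHS]mul1r.
have z_sol (n : nat) : msum_to (fun j => A j *m z (n%:Z - j%:Z))
    (z (n%:Z + 1) + lambda ^ n *: w).
  (* The history bound makes the series of [z] converge; adding the series of [y] then evaluates
     [volterra_op] along [x]. *)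
  have [S zS] := kernel_msum_ex hN cvgA (Nz n).
  suff -> : z (n%:Z + 1) + lambda ^ n *: w = S by [].
  have xS : msum_to (fun j => A j *m x (n%:Z - j%:Z))
      (S + (y (n%:Z + 1) - g n)).
    apply: msum_to_ext (msum_toD zS (forced_msum A g n)) _ _ => // j.
    by rewrite -mulmxDr subrK.
  rewrite /z x_sol /volterra_op (msum_to_limn xS) -/(g n).
  move: (y _) (g n) => Y G; apply/matrixP => k l; rewrite !mxE. ring.
have [B MB] := resonance_bound gamma_gt0 cvgA cvg2A lambda1 z_hist z_sol q_null.
have qw : (q *m w) 0 0 = (a%:C%C : C) * q 0 i.
  by rewrite -scalemxAr mxE -colE mxE.
have t0 : 0 < cabs ((q *m w) 0 0).
  rewrite lt0r cabs_ge0 andbT; apply/eqP => /cabs_eq0 /eqP.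
  rewrite qw mulf_eq0 (negPf qi) orbF => /eqP /complexI a00.
  by move: a0; rewrite a00 ltxx.
(* An integer M beyond B / |q w| contradicts the bound M |q w| <= B. *)
have := MB (Num.bound (B / cabs ((q *m w) 0 0))).
rewrite cabsM -(rmorph_nat (real_complex R)) cabs_real ger0_norm ?ler0n //.
rewrite -ler_pdivlMr // leNgt; apply/negP; rewrite negbK.
apply: archi_boundP; rewrite divr_ge0 ?cabs_ge0 //.
by apply: le_trans (MB 0%N); exact: cabs_ge0.
Qed.

End ShadowableNoRoot.

Unset Implicit Arguments.
Set Strict Implicit.

Theorem theorem4 (R : realType) (d : nat) (hd : (0 < d)%N)
    (N : 'cV[Cplx R]_d -> R) (hN : is_norm N)
    (gamma : R) (hgamma : 0 < gamma)
    (A : nat -> 'M[Cplx R]_d)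
    (hA : (\sum_(0 <= j <oo) (op_norm N (A j) * (expR (gamma * j%:R))%:E)
             < +oo)%E) :
  shadowable N gamma A <->
  ~ (exists lambda : Cplx R, char_root gamma A lambda /\ `|lambda| = 1).
Proof.
have cvgA := cvg_weighted_kernel hN hA.
have cvg2A := cvg_quadratic_kernel hN hgamma hA.
split; first exact: shadowable_no_root.
exact: no_root_shadowable.
Qed.
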